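(* Let $X,Y,Z$ be strongly minimal sets definable in a sufficiently saturated structure $\mathcal{M}$ and let $F\subseteq X\times Y\times Z$ be a definable set of Morley rank $2$. If the Morley degree of $F$ is $1$, then the following three conditions are mutually exclusive (no two of them hold simultaneously). (a) There is some real $\varepsilon>0$ such that for all $A\subseteq X$, $B\subseteq Y$, $C\subseteq Z$ with $|A|,|B|,|C|\le n$ we have $|F\cap (A\times B\times C)|=O(n^{2-\varepsilon})$. (b) $F$ is group-like. (c) $F$ is cylindrical.
   Context: Algebraic closure $\operatorname{acl}$ is always taken in $\mathcal{M}^{\mathrm{eq}}$; $\operatorname{RM}$ denotes Morley rank; ''definable'' means definable with parameters. The $O$-notation: $f(n)=O(g(n))$ means there are $K>0$ and $n_0\in\mathbb{N}$ with $f(n)\le K g(n)$ for all $n>n_0$. In (a), $\varepsilon$, $K$ and $n_0$ depend on $F$ but not on $A,B,C$. Cartesian: a subset $E\subseteq U\times V$ is cartesian if $I\times J\subseteq E$ for some infinite $I\subseteq U$, $J\subseteq V$. Cylindrical: $E\subseteq S_1\times\dots\times S_k$ is cylindrical if for some $i\in\{1,\dots,k\}$ it is cartesian as a subset of $S_i\times\prod_{j\ne i}S_j$. Generic: $\bar a=(a_1,a_2,a_3)\in F$ is generic in $F$ over a set of parameters $C$ if $\operatorname{RM}(\bar a/C)=\operatorname{RM}(F)=2$. Group-like: $F$ is group-like if there are a group $G$ of Morley rank $1$ and Morley degree $1$ (hence abelian) definable in $\mathcal{M}$ over a small set of parameters $C\subseteq X\times Y\times Z$, elements $g_1,g_2,g_3\in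 G$, and $\alpha_1\in X$, $\alpha_2\in Y$, $\alpha_3\in Z$ such that $\alpha_i$ and $g_i$ are inter-algebraic over $C$ for $i=1,2,3$ (i.e. $\alpha_i\in\operatorname{acl}(g_iC)$ and $g_i\in\operatorname{acl}(\alpha_iC)$), $(\alpha_1,\alpha_2,\alpha_3)\in F$ is generic in $F$ over $C$, and $g_1\cdot g_2\cdot g_3=1$ in $G$.
   Formalization: In ''group-like'', definability, inter-algebraicity and genericity are taken over C together with a small set of parameters defining X, Y, Z and F; with genericity over C alone the claim fails (x+y+z=0 generic over the empty set, F the plane x=a1). *)

(* Defs.v *)
From HB Require Import structures.
From mathcomp Require Import all_boot all_order all_algebra.
From mathcomp Require Import all_classical all_reals exp.

Set Implicit Arguments.
Unset Strict Implicit.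
Unset Printing Implicit Defensive.

Import Order.TTheory GRing.Theory Num.Theory.

Local Open Scope classical_set_scope.
Local Open Scope card_scope.

(* Structures are many-sorted, so that M and M^eq are objects of the same     *)
(* kind; a one-sorted structure is the case of a signature with one sort.     *)
(* A context is a bracketed finite product of sorts.  It is at once the arity *)
(* of a symbol, the list of free variables of a formula, and the type of a    *)
(* tuple: [tup C (Prod Γ Δ)] is by definition [tup C Γ * tup C Δ].            *)

Inductive ctx (S : Type) : Type :=
  | Nil
  | One (s : S)
  | Prod (Γ Δ : ctx S).
Arguments Nil {S}.

Fixpoint var (S : Type) (Γ : ctx S) : Type :=
  match Γ with
  | Nil => void
  | One _ => unit
  | Prod Γ Δ => (var Γ + var Δ)%type
  end.

Fixpoint srt (S : Type) (Γ : ctx S) : var Γ -> S :=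
  match Γ return var Γ -> S with
  | Nil => fun v => match v with end
  | One s => fun=> s
  | Prod Γ Δ => fun v => match v with inl i => srt i | inr j => srt j end
  end.

Fixpoint tup (S : Type) (C : S -> Type) (Γ : ctx S) : Type :=
  match Γ with
  | Nil => unit
  | One s => C s
  | Prod Γ Δ => (tup C Γ * tup C Δ)%type
  end.

Fixpoint lookup (S : Type) (C : S -> Type) (Γ : ctx S) :
    tup C Γ -> forall v : var Γ, C (srt v) :=
  match Γ return tup C Γ -> forall v : var Γ, C (srt v) with
  | Nil => fun _ v => match v with end
  | One _ => fun a _ => a
  | Prod Γ Δ => fun a v =>
      match v as w return C (@srt S (Prod Γ Δ) w) with
      | inl i => lookup a.1 i
      | inr j => lookup a.2 j
      end
  end.

Fixpoint tabulate (S : Type) (C : S -> Type) (Γ : ctx S) :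
    (forall v : var Γ, C (srt v)) -> tup C Γ :=
  match Γ return (forall v : var Γ, C (srt v)) -> tup C Γ with
  | Nil => fun=> tt
  | One _ => fun f => f tt
  | Prod _ _ => fun f => (tabulate (fun i => f (inl i)),
                          tabulate (fun j => f (inr j)))
  end.

Fixpoint map_ctx (S T : Type) (h : S -> T) (Γ : ctx S) : ctx T :=
  match Γ with
  | Nil => Nil
  | One s => One (h s)
  | Prod Γ Δ => Prod (map_ctx h Γ) (map_ctx h Δ)
  end.

Fixpoint tup_of_map (S T : Type) (h : S -> T) (C : T -> Type) (Γ : ctx S) :
    tup C (map_ctx h Γ) -> tup (fun s => C (h s)) Γ :=
  match Γ return tup C (map_ctx h Γ) -> tup (fun s => C (h s)) Γ with
  | Nil => id
  | One _ => id
  | Prod _ _ => fun a => (tup_of_map a.1, tup_of_map a.2)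
  end.

Record signature := Signature {
  sorts : Type;
  functions : Type;
  fdom : functions -> ctx sorts;
  fcod : functions -> sorts;
  relations : Type;
  rdom : relations -> ctx sorts
}.

Record structure (L : signature) := Structure {
  carrier : sorts L -> Type;
  fint : forall f : functions L, tup carrier (fdom f) -> carrier (fcod f);
  rint : forall r : relations L, set (tup carrier (rdom r))
}.

Inductive term (L : signature) (Γ : ctx (sorts L)) : sorts L -> Type :=
  | Var (v : var Γ) : term Γ (srt v)
  | App (f : functions L) (args : forall i : var (fdom f), term Γ (srt i)) :
      term Γ (fcod f).

Inductive formula (L : signature) (Γ : ctx (sorts L)) : Type :=
  | Bot
  | Equal (s : sorts L) (t u : term Γ s)
  | Rel (r : relations L) (args : forall i : var (rdom r), term Γ (srt i))
  | Imp (φ ψ : formula Γ)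
  | All (s : sorts L) (φ : formula (Prod Γ (One s))).

Notation tuple_in M Γ := (tup (@carrier _ M) Γ).

Fixpoint eval (L : signature) (M : structure L) (Γ : ctx (sorts L))
    (a : tuple_in M Γ) (s : sorts L) (t : term Γ s) : carrier M s :=
  match t in term _ s return carrier M s with
  | Var v => lookup a v
  | App f args => fint (tabulate (fun i => eval a (args i)))
  end.

Fixpoint sat (L : signature) (M : structure L) (Γ : ctx (sorts L))
    (φ : formula Γ) : tuple_in M Γ -> Prop :=
  match φ with
  | Bot => fun=> False
  | Equal _ t u => fun a => eval a t = eval a u
  | Rel r args => fun a => @rint _ M r (tabulate (fun i => eval a (args i)))
  | Imp φ ψ => fun a => sat φ a -> sat ψ a
  | All s φ => fun a => forall x : carrier M s, @sat _ M (Prod _ (One s)) φ (a, x)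
  end.

Definition elt (L : signature) (M : structure L) : Type :=
  {s : sorts L & carrier M s}.

Definition coords (L : signature) (M : structure L) (Γ : ctx (sorts L))
    (a : tuple_in M Γ) : set (elt M) :=
  range (fun v : var Γ => existT (carrier M) (srt v) (lookup a v)).

Definition definable_over (L : signature) (M : structure L)
    (P : set (elt M)) (Γ : ctx (sorts L)) (D : set (tuple_in M Γ)) : Prop :=
  exists (Δ : ctx (sorts L)) (φ : formula (Prod Γ Δ)) (b : tuple_in M Δ),
    coords b `<=` P /\ D = [set a | @sat _ M (Prod Γ Δ) φ (a, b)].

Definition definable (L : signature) (M : structure L) (Γ : ctx (sorts L))
    (D : set (tuple_in M Γ)) : Prop :=
  definable_over setT D.

Definition acl (L : signature) (M : structure L) (P : set (elt M)) :
    set (elt M) :=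
  [set e | exists D : set (carrier M (projT1 e)),
      [/\ @definable_over _ M P (One (projT1 e)) D, finite_set D
        & D (projT2 e)]].

(* M^eq: besides the sorts of M, one sort for each equivalence relation       *)
(* defined in M by a formula without parameters; its elements are the         *)
(* equivalence classes.  The new symbols are the quotient maps.               *)

Record imaginary_sort (L : signature) (M : structure L) := ImaginarySort {
  im_ctx : ctx (sorts L);
  im_rel : formula (Prod im_ctx im_ctx);
  im_class : tuple_in M im_ctx -> set (tuple_in M im_ctx) :=
    fun a => [set b | @sat _ M (Prod im_ctx im_ctx) im_rel (a, b)];
  im_refl : forall a, im_class a a;
  im_sym : forall a b, im_class a b -> im_class b a;
  im_trans : forall a b c, im_class a b -> im_class b c -> im_class a c
}.

Definition eq_sort (L : signature) (M : structure L) : Type :=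
  (sorts L + imaginary_sort M)%type.

Definition eq_signature (L : signature) (M : structure L) : signature :=
  @Signature (eq_sort M)
    (functions L + imaginary_sort M)%type
    (fun f => match f with
              | inl f => map_ctx inl (fdom f)
              | inr e => map_ctx inl (im_ctx e)
              end)
    (fun f => match f with
              | inl f => inl (fcod f)
              | inr e => inr e
              end)
    (relations L)
    (fun r => map_ctx inl (rdom r)).

Definition eq_carrier (L : signature) (M : structure L) (s : eq_sort M) : Type :=
  match s with
  | inl s => carrier M s
  | inr e => {A : set (tuple_in M (im_ctx e)) | exists a, A = im_class a}
  end.

Definition home_tuple (L : signature) (M : structure L) (Γ : ctx (sorts L))
    (a : tup (@eq_carrier L M) (map_ctx inl Γ)) : tuple_in M Γ :=
  tup_of_map a.

Definition eq_structure (L : signature) (M : structure L) :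
    structure (eq_signature M) :=
  @Structure (eq_signature M) (@eq_carrier L M)
    (fun f => match f return tup (@eq_carrier L M) (@fdom (eq_signature M) f) ->
                             eq_carrier (@fcod (eq_signature M) f) with
              | inl f => fun a => fint (home_tuple a)
              | inr e => fun a => exist _ (im_class (home_tuple a))
                                    (ex_intro _ (home_tuple a) erefl)
              end)
    (fun r => [set a | @rint _ M r (home_tuple a)]).

Definition to_eq (L : signature) (M : structure L) (e : elt M) :
    elt (eq_structure M) :=
  existT (carrier (eq_structure M)) (inl (projT1 e)) (projT2 e).

(* [a] is in acl^eq(P) *)
Definition algebraic_over (L : signature) (M : structure L)
    (P : set (elt M)) (Γ : ctx (sorts L)) (a : tuple_in M Γ) : Prop :=
  @to_eq L M @` coords a `<=` acl (@to_eq L M @` P).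

Definition interalgebraic_over (L : signature) (M : structure L)
    (P : set (elt M)) (Γ Δ : ctx (sorts L))
    (a : tuple_in M Γ) (b : tuple_in M Δ) : Prop :=
  algebraic_over (coords b `|` P) a /\ algebraic_over (coords a `|` P) b.

(* The type K stands for the cardinal |K|: [small K A] says |A| < |K|. *)
Definition small (K T : Type) (A : set T) : Prop := ~~ ([set: K] #<= A).

(* |K| > |L| + aleph_0 and M is |K|-saturated: every finitely satisfiable     *)
(* set of formulas in one variable over fewer than |K| parameters is realized *)
(* (formulas are replaced by the sets they define).                           *)
Definition sufficiently_saturated (K : Type) (L : signature)
    (M : structure L) : Prop :=
  small K [set: sorts L + functions L + relations L + nat] /\
  forall (P : set (elt M)) (s : sorts L) (p : set (set (carrier M s))),
    small K P ->
    (forall D, p D -> @definable_over _ M P (One s) D) ->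
    (forall q, q `<=` p -> finite_set q -> \bigcap_(D in q) D !=set0) ->
    \bigcap_(D in p) D !=set0.

(* The notions below use only definable sets of M itself; they are the usual  *)
(* ones when M is saturated.                                                  *)

Definition strongly_minimal (L : signature) (M : structure L)
    (Γ : ctx (sorts L)) (X : set (tuple_in M Γ)) : Prop :=
  [/\ definable X, infinite_set X
    & forall D, definable D -> D `<=` X ->
        finite_set D \/ finite_set (X `\` D)].

(* RM(D) >= n, for definable D and finite n *)
Fixpoint RM_ge (L : signature) (M : structure L) (Γ : ctx (sorts L)) (n : nat)
    (D : set (tuple_in M Γ)) : Prop :=
  match n with
  | 0 => D !=set0
  | n.+1 => exists E : nat -> set (tuple_in M Γ),
      (forall i, [/\ definable (E i), E i `<=` D & RM_ge n (E i)]) /\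
      trivIset setT E
  end.

Definition has_RM (L : signature) (M : structure L) (Γ : ctx (sorts L))
    (D : set (tuple_in M Γ)) (n : nat) : Prop :=
  RM_ge n D /\ ~ RM_ge n.+1 D.

Definition MD_ge (L : signature) (M : structure L) (Γ : ctx (sorts L))
    (n d : nat) (D : set (tuple_in M Γ)) : Prop :=
  exists E : 'I_d -> set (tuple_in M Γ),
    (forall i, [/\ definable (E i), E i `<=` D & has_RM (E i) n]) /\
    trivIset setT E.

(* D has finite Morley rank and Morley degree d *)
Definition has_MD (L : signature) (M : structure L) (Γ : ctx (sorts L))
    (D : set (tuple_in M Γ)) (d : nat) : Prop :=
  exists n, [/\ has_RM D n, MD_ge n d D & ~ MD_ge n d.+1 D].

(* RM(a/P) = n: the least rank of a P-definable set containing a is n *)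
Definition has_RM_over (L : signature) (M : structure L) (P : set (elt M))
    (Γ : ctx (sorts L)) (a : tuple_in M Γ) (n : nat) : Prop :=
  (exists D, [/\ definable_over P D, D a & has_RM D n]) /\
  (forall D, definable_over P D -> D a -> RM_ge n D).

Definition generic_in (L : signature) (M : structure L) (P : set (elt M))
    (Γ : ctx (sorts L)) (F : set (tuple_in M Γ)) (a : tuple_in M Γ) : Prop :=
  F a /\ exists n, has_RM F n /\ has_RM_over P a n.

(* An abstract group G, identified through [iota] with a P-definable set on   *)
(* which the group operation is P-definable.                                  *)
Definition definable_group (L : signature) (M : structure L) (P : set (elt M))
    (Γ : ctx (sorts L)) (G : groupType) (iota : G -> tuple_in M Γ) : Prop :=
  [/\ injective iota,
      definable_over P (range iota)
    & @definable_over _ M P (Prod (Prod Γ Γ) Γ)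
        [set t | exists x y : G, t = (iota x, iota y, iota (x * y)%g)]].

(* B is a set over which X, Y, Z and F are defined.  As usual, its elements   *)
(* count as named by constants, so "over C" means over B and C.  This matters *)
(* for genericity: in a field, a solution (a1, a2, a3) of x + y + z = 0 of    *)
(* rank 2 over the empty set also lies in the plane x = a1, of rank 2, but    *)
(* should not be called generic in that plane, which is not defined over the  *)
(* empty set.                                                                 *)
Definition group_like (K : Type) (L : signature) (M : structure L)
    (B : set (elt M)) (Γ1 Γ2 Γ3 : ctx (sorts L))
    (X : set (tuple_in M Γ1)) (Y : set (tuple_in M Γ2))
    (Z : set (tuple_in M Γ3))
    (F : set (tuple_in M (Prod (Prod Γ1 Γ2) Γ3))) : Prop :=
  exists C : set (tuple_in M (Prod (Prod Γ1 Γ2) Γ3)),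
  let P := B `|` \bigcup_(c in C) coords c in
  [/\ C `<=` X `*` Y `*` Z, small K C &
  exists (Γ : ctx (sorts L)) (G : groupType) (iota : G -> tuple_in M Γ),
  [/\ definable_group P iota, has_RM (range iota) 1, has_MD (range iota) 1 &
  exists (g1 g2 g3 : G)
    (a1 : tuple_in M Γ1) (a2 : tuple_in M Γ2) (a3 : tuple_in M Γ3),
  [/\ [/\ X a1, Y a2 & Z a3],
      [/\ interalgebraic_over P a1 (iota g1),
          interalgebraic_over P a2 (iota g2)
        & interalgebraic_over P a3 (iota g3)],
      generic_in P F (a1, a2, a3)
    & (g1 * g2 * g3 = 1)%g]]].

Definition cartesian (U V : Type) (S : set U) (T : set V) (E : set (U * V)) :
    Prop :=
  exists (I : set U) (J : set V),
    [/\ I `<=` S, J `<=` T, infinite_set I, infinite_set J & I `*` J `<=` E].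

Definition cylindrical (U V W : Type) (X : set U) (Y : set V) (Z : set W)
    (E : set (U * V * W)) : Prop :=
  [\/ cartesian X (Y `*` Z) [set p | E (p.1, p.2.1, p.2.2)],
      cartesian Y (X `*` Z) [set p | E (p.2.1, p.1, p.2.2)]
    | cartesian Z (X `*` Y) [set p | E (p.2.1, p.2.2, p.1)]].

(* S is finite and |S| <= r *)
Definition card_bounded (R : realType) (T : Type) (S : set T) (r : R) : Prop :=
  exists2 m : nat, S #= `I_m & (m%:R <= r)%R.

Definition power_saving (R : realType) (U V W : Type)
    (X : set U) (Y : set V) (Z : set W) (F : set (U * V * W)) : Prop :=
  exists2 eps : R, (0 < eps)%R &
  exists2 k : R, (0 < k)%R &
  exists n0 : nat, forall n : nat, (n0 < n)%N ->
  forall (A : set U) (B : set V) (C : set W),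
    A `<=` X -> B `<=` Y -> C `<=` Z ->
    A #<= `I_n -> B #<= `I_n -> C #<= `I_n ->
    card_bounded (F `&` (A `*` B `*` C)) (k * (n%:R `^ (2 - eps)))%R.

(* Main.v *)
Require Import Defs.
From mathcomp Require Import all_boot all_order all_algebra.
From mathcomp Require Import finmap ring.
From mathcomp Require Import all_classical all_reals exp.

(* Two facts on Morley rank suffice: infinitely many disjoint infinite fibres *)
(* force rank at least 2, and a set mapped with boundedly finite fibres into  *)
(* a strongly minimal set has rank at most 1.                                 *)
(*                                                                            *)
(* Suppose F is group-like.  Eliminating imaginaries from acl^eq over real    *)
(* elements gives P-definable relations R_i between the i-th coordinate and   *)
(* G, with all fibres of size at most N, that hold at (alpha_i, g_i); every   *)
(* P-definable set containing alpha has rank at least 2.                      *)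
(*                                                                            *)
(* (b) excludes (c): the set F' of points of F related to some triple with    *)
(* product 1 contains alpha, hence has rank 2, and any two coordinates of a   *)
(* point of F' determine the third up to finitely many values.  If I x J is   *)
(* contained in F, then F \ F' still has infinite fibres over J, so it also   *)
(* has rank 2, although F has degree 1.                                       *)
(*                                                                            *)
(* (b) excludes (a): for almost all x and then almost all y in G, the triple  *)
(* (x, y, (x y)^-1) is related to a point of F.  So every finite S in G has   *)
(* translates g S and S h all of whose pairs come from F.  If S S has at most *)
(* 2 |S| elements, the points related to g S, S h and (g S S h)^-1 form a box *)
(* of side O(|S|) with at least |S|^2 / N^2 points of F.                      *)
(*                                                                            *)
(* (c) excludes (a): an infinite grid contains n x n grids.                   *)

(** The exclusions come down to a rank computation and a count. Interalgebraicity gives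
    finite-to-finite [P]-definable relations between points of F and triples of G with product 1
    ([interalgebraic_family]). Every [P]-definable set containing the generic point has rank at
    least 2, whereas a set with boundedly finite fibres over a strongly minimal set has smaller rank
    ([bounded_to_one_RM]). Applied to suitable sets of configurations, this shows that the property
    of being completed to a configuration holds almost everywhere in G ([second_factors_cofinite]),
    which gives the grids of [configuration_grid].

    The count in [configuration_not_power_saving] needs arbitrarily large finite S in G with |S S|
    at most 2 |S| ([small_doubling]). Definable subsets of G are finite or cofinite. If some element
    has infinite order, S is a progression; otherwise G is an infinite torsion group, abelian by
    Reineke's argument ([torsion_abelian]), and S is a finite subgroup.
    [configuration_not_cylindrical] uses rank and degree only, and [power_saving_not_cylindrical]
    only counts. *)

Set Implicit Arguments.
Unset Strict Implicit.
Unset Printing Implicit Defensive.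

Local Open Scope classical_set_scope.
Local Open Scope card_scope.

(** * Definable sets *)

Section TermMaps.
Variables (L : signature) (M : structure L).
Implicit Types Γ Δ Θ : ctx (sorts L).

Lemma tabulate_lookup Γ (a : tuple_in M Γ) : tabulate (lookup a) = a.
Proof.
elim: Γ a => [|s|Γ IH1 Δ IH2] /=; [by case|by []|].
by case=> a b /=; rewrite (IH1 a) (IH2 b).
Qed.

Lemma lookup_tabulate Γ (f : forall v : var Γ, carrier M (srt v)) v :
  lookup (tabulate f) v = f v.
Proof.
elim: Γ f v => [|s|Γ IH1 Δ IH2] /= f; [by case|by case|].
by case=> v /=; [rewrite (IH1 (fun i => f (inl i)))|rewrite (IH2 (fun i => f (inr i)))].
Qed.

(** A tuple of terms, kept as the function it defines: substitution into a formula becomes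
    composition of functions. *)
Definition term_map Γ Δ (f : tuple_in M Γ -> tuple_in M Δ) : Prop :=
  exists σ : forall v : var Δ, term Γ (srt v),
    forall a, f a = tabulate (fun v => eval a (σ v)).

Lemma eval_term_map Γ Δ (f : tuple_in M Γ -> tuple_in M Δ) s (t : term Δ s) :
  term_map f -> exists t' : term Γ s, forall a, eval a t' = eval (f a) t.
Proof.
move=> [σ fE]; elim: t => [v|g args IH].
  by exists (σ v) => a /=; rewrite fE lookup_tabulate.
have /cid[u uE] : exists u : forall i, term Γ (srt i),
    forall i a, eval a (u i) = eval (f a) (args i).
  by exists (fun i => sval (cid (IH i))) => i a; case: cid.
by exists (App u) => a /=; congr fint; congr tabulate; apply: functional_extensionality_dep => i.
Qed.

Lemma term_map_comp Γ Δ Θ (f : tuple_in M Γ -> tuple_in M Δ)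
    (g : tuple_in M Δ -> tuple_in M Θ) :
  term_map f -> term_map g -> term_map (fun a => g (f a)).
Proof.
move=> hf [σ gE].
exists (fun v => sval (cid (eval_term_map (σ v) hf))) => a.
by rewrite gE; congr tabulate; apply: functional_extensionality_dep => v; case: cid.
Qed.

Lemma term_map_id Γ : term_map (fun a : tuple_in M Γ => a).
Proof. by exists (fun v => Var v) => a /=; rewrite tabulate_lookup. Qed.

Lemma term_map_fst Γ Δ : @term_map (Prod Γ Δ) Γ (fun a => a.1).
Proof.
by exists (fun v => @Var L (Prod Γ Δ) (inl v)) => a /=; rewrite tabulate_lookup.
Qed.

Lemma term_map_snd Γ Δ : @term_map (Prod Γ Δ) Δ (fun a => a.2).
Proof.
by exists (fun v => @Var L (Prod Γ Δ) (inr v)) => a /=; rewrite tabulate_lookup.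
Qed.

Lemma term_map_pair Γ Δ Θ (f : tuple_in M Γ -> tuple_in M Δ)
    (g : tuple_in M Γ -> tuple_in M Θ) :
  term_map f -> term_map g -> @term_map Γ (Prod Δ Θ) (fun a => (f a, g a)).
Proof.
move=> [σ fE] [τ gE].
exists (fun v : var (Prod Δ Θ) => match v return @term L Γ (@srt _ (Prod Δ Θ) v) with
  | inl i => σ i | inr j => τ j end) => a /=.
by rewrite fE gE.
Qed.

Lemma term_map_tt Γ : @term_map Γ Defs.Nil (fun=> tt).
Proof. by exists (fun v : var Defs.Nil => match v with end). Qed.

Lemma term_map_lookup Γ (v : var Γ) :
  @term_map Γ (One (srt v)) (fun a => lookup a v).
Proof. by exists (fun=> Var v). Qed.

Lemma term_map_fint (f : functions L) :
  @term_map (fdom f) (One (fcod f)) (fun a => @fint _ M f a).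
Proof.
by exists (fun=> App (fun i => Var i)) => a /=; rewrite tabulate_lookup.
Qed.

End TermMaps.

Arguments term_map_id {L M} Γ.
Arguments term_map_fst {L M} Γ Δ.
Arguments term_map_snd {L M} Γ Δ.
Arguments term_map_tt {L M} Γ.
Arguments term_map_fint {L M} f.
Arguments term_map_lookup {L M Γ} v.

(* [tup C (Prod Γ Δ)] unfolds to a product type, from which the context has *)
(* to be read back.                                                         *)
Ltac ctx_of T :=
  lazymatch T with
  | prod ?T1 ?T2 =>
    let B1 := ctx_of T1 in let B2 := ctx_of T2 in constr:(Prod B1 B2)
  | carrier _ ?s => constr:(One s)
  | _ ?B => constr:(B)
  end.

Ltac solve_term_map :=
  lazymatch goal with
  | |- @term_map _ _ _ _ (fun a => a) => exact: term_map_id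
  | |- @term_map ?L ?M ?A (Prod ?B ?C) (fun a => (@?f a, @?g a)) =>
    apply: (@term_map_pair L M A B C f g); solve_term_map
  | |- @term_map ?L ?M ?A _ (fun a => @fst ?T1 ?T2 (@?f a)) =>
    let B := ctx_of T1 in let C := ctx_of T2 in
    apply: (@term_map_comp L M A (Prod B C) B f (fun x => x.1));
    [solve_term_map | exact: term_map_fst]
  | |- @term_map ?L ?M ?A _ (fun a => @snd ?T1 ?T2 (@?f a)) =>
    let B := ctx_of T1 in let C := ctx_of T2 in
    apply: (@term_map_comp L M A (Prod B C) C f (fun x => x.2));
    [solve_term_map | exact: term_map_snd]
  | hf : @term_map _ _ ?B _ ?f |- @term_map ?L ?M ?A ?C (fun a => ?f (@?g a)) =>
    refine (@term_map_comp L M A B C g f _ hf); solve_term_map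
  end.

(** * Sets definable over parameters *)

Section Definability.
Variables (L : signature) (M : structure L).
Implicit Types Γ Δ Θ : ctx (sorts L).

Definition definable0 Γ (D : set (tuple_in M Γ)) : Prop :=
  exists φ : formula Γ, D = [set a | sat φ a].

(** Substitution, by induction on the formula; under a quantifier the map is extended by the
    identity on the bound variable. *)
Lemma definable0_preimage Γ Δ (f : tuple_in M Γ -> tuple_in M Δ)
    (D : set (tuple_in M Δ)) :
  term_map f -> definable0 D -> definable0 [set a | D (f a)].
Proof.
move=> hf [φ ->].
suff [ψ ψE] : exists ψ : formula Γ, forall a, sat ψ a <-> sat φ (f a).
  by exists ψ; apply/seteqP; split=> a /ψE.
elim: φ Γ f hf => [Θ|Θ s t u|Θ r args|Θ φ IH1 ψ IH2|Θ s φ IH] Γ f hf.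
- by exists (Bot _).
- have [t' t'E] := eval_term_map t hf; have [u' u'E] := eval_term_map u hf.
  by exists (Equal t' u') => a /=; rewrite t'E u'E.
- exists (Rel (fun i => sval (cid (eval_term_map (args i) hf)))) => a /=.
  suff -> : tabulate (fun i => eval a (sval (cid (eval_term_map (args i) hf)))) =
     tabulate (fun i => eval (f a) (args i)) by [].
  by congr tabulate; apply: functional_extensionality_dep => i; case: cid.
- have [φ' φE] := IH1 _ _ hf; have [ψ' ψE] := IH2 _ _ hf.
  by exists (Imp φ' ψ') => a /=; split=> h /φE /h /ψE.
- have hg : @term_map L M (Prod Γ (One s)) (Prod Θ (One s)) (fun a => (f a.1, a.2)).
    solve_term_map.
  have [ψ ψE] := IH _ _ hg.
  by exists (All ψ) => a; split=> h x; [exact: (proj1 (ψE (a, x)) (h x))|exact: (proj2 (ψE (a, x)) (h x))].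
Qed.

Lemma definable0_imp Γ (D E : set (tuple_in M Γ)) :
  definable0 D -> definable0 E -> definable0 [set a | D a -> E a].
Proof. by move=> [φ ->] [ψ ->]; exists (Imp φ ψ). Qed.

Lemma definable0_False Γ : @definable0 Γ [set a | False].
Proof. by exists (Bot _). Qed.

Lemma definable0_not Γ (D : set (tuple_in M Γ)) :
  definable0 D -> definable0 [set a | ~ D a].
Proof. by move=> hD; apply: definable0_imp (definable0_False _). Qed.

Lemma definable0_and Γ (D E : set (tuple_in M Γ)) :
  definable0 D -> definable0 E -> definable0 [set a | D a /\ E a].
Proof.
move=> hD hE; have := definable0_not (definable0_imp hD (definable0_not hE)).
congr definable0; apply/seteqP; split=> a /=; last by case=> ha hb; apply.
by move=> h; split; apply: contrapT => n; apply: h => // hD' /n.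
Qed.

(** Formulas quantify one element at a time, so a quantifier over a tuple is unfolded along its
    context, reassociating the product at each step. *)
Lemma definable0_forall Γ Δ (D : set (tuple_in M (Prod Γ Δ))) :
  definable0 D -> definable0 [set a | forall b, D (a, b)].
Proof.
elim: Δ Γ D => [|s|Δ1 IH1 Δ2 IH2] Γ D hD.
- have := definable0_preimage (term_map_pair (term_map_id Γ) (term_map_tt Γ)) hD.
  by congr definable0; apply/seteqP; split=> a /= h; [case|apply: h].
- by case: hD => φ ->; exists (All φ).
- have hf : @term_map L M (Prod (Prod Γ Δ1) Δ2) (Prod Γ (Prod Δ1 Δ2))
      (fun a => (a.1.1, (a.1.2, a.2))).
    solve_term_map.
  have := IH1 _ _ (IH2 _ _ (definable0_preimage hf hD)).
  by congr definable0; apply/seteqP; split=> a /= h; [case=> b c; exact: h|move=> b c; exact: h].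
Qed.

Lemma definable0_eq Γ : @definable0 (Prod Γ Γ) [set a | a.1 = a.2].
Proof.
elim: Γ => [|s|Γ IH1 Δ IH2].
- have := @definable0_not (Prod Defs.Nil Defs.Nil) _ (definable0_False _).
  by congr definable0; apply/seteqP; split=> -[[] []] _ /=; [|case].
- by exists (Equal (@Var L (Prod (One s) (One s)) (inl tt)) (@Var L (Prod (One s) (One s)) (inr tt))).
- have p1 : @term_map L M (Prod (Prod Γ Δ) (Prod Γ Δ)) (Prod Γ Γ) (fun a => (a.1.1, a.2.1)).
    solve_term_map.
  have p2 : @term_map L M (Prod (Prod Γ Δ) (Prod Γ Δ)) (Prod Δ Δ) (fun a => (a.1.2, a.2.2)).
    solve_term_map.
  have := definable0_and (definable0_preimage p1 IH1) (definable0_preimage p2 IH2).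
  by congr definable0; apply/seteqP; split=> -[[a b] [c d]] /=; [case=> -> ->|case].
Qed.

Implicit Types P : set (elt M).

Lemma coords_pair Γ Δ (a : tuple_in M Γ) (b : tuple_in M Δ) :
  @coords L M (Prod Γ Δ) (a, b) = coords a `|` coords b.
Proof.
apply/seteqP; split=> e.
  by case=> -[v|v] _ <-; [left|right]; exists v.
by case=> -[v _ <-]; [exists (inl v)|exists (inr v)].
Qed.

Lemma definable_overP P Γ (D : set (tuple_in M Γ)) :
  definable_over P D <-> exists Δ (E : set (tuple_in M (Prod Γ Δ))) (b : tuple_in M Δ),
    [/\ definable0 E, coords b `<=` P & D = [set a | E (a, b)]].
Proof.
split.
  by case=> Δ [φ] [b] [bP ->]; exists Δ, [set a | sat φ a], b; split=> //; exists φ.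
by case=> Δ [_] [b] [[φ ->] bP ->]; exists Δ, φ, b.
Qed.

Lemma definable_over0 P Γ (D : set (tuple_in M Γ)) : definable0 D -> definable_over P D.
Proof.
move=> hD; apply/definable_overP; exists Defs.Nil, [set a : tuple_in M (Prod Γ Defs.Nil) | D a.1], tt.
by split=> //; [exact: definable0_preimage (term_map_fst _ _) hD|case=> ? ? []].
Qed.

Lemma definable_overS P P' Γ (D : set (tuple_in M Γ)) :
  P `<=` P' -> definable_over P D -> definable_over P' D.
Proof.
by move=> sP [Δ] [φ] [b] [bP ->]; exists Δ, φ, b; split=> //; apply: subset_trans sP.
Qed.

Lemma definable_over_preimage P Γ Δ (f : tuple_in M Γ -> tuple_in M Δ)
    (D : set (tuple_in M Δ)) :
  term_map f -> definable_over P D -> definable_over P [set a | D (f a)].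
Proof.
move=> hf /definable_overP[Θ] [E] [b] [hE bP ->]; apply/definable_overP.
exists Θ, [set a : tuple_in M (Prod Γ Θ) | E (f a.1, a.2)], b; split=> //.
apply: (@definable0_preimage _ _ (fun a : tuple_in M (Prod Γ Θ) =>
  (f a.1, a.2) : tuple_in M (Prod _ _))) hE.
solve_term_map.
Qed.

Lemma definable_over_imp P Γ (D E : set (tuple_in M Γ)) :
  definable_over P D -> definable_over P E -> definable_over P [set a | D a -> E a].
Proof.
move=> /definable_overP[Δ] [D'] [b] [hD bP ->] /definable_overP[Θ] [E'] [c] [hE cP ->].
apply/definable_overP; exists (Prod Δ Θ),
  [set a : tuple_in M (Prod Γ (Prod Δ Θ)) | D' (a.1, a.2.1) -> E' (a.1, a.2.2)], (b, c).
split=> //; last by rewrite coords_pair subUset.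
apply: definable0_imp.
- apply: (@definable0_preimage _ _ (fun a : tuple_in M (Prod Γ (Prod Δ Θ)) =>
    (a.1, a.2.1) : tuple_in M (Prod _ _))) hD.
  solve_term_map.
- apply: (@definable0_preimage _ _ (fun a : tuple_in M (Prod Γ (Prod Δ Θ)) =>
    (a.1, a.2.2) : tuple_in M (Prod _ _))) hE.
  solve_term_map.
Qed.

Lemma definable_over_not P Γ (D : set (tuple_in M Γ)) :
  definable_over P D -> definable_over P [set a | ~ D a].
Proof. by move=> hD; apply: definable_over_imp => //; exact/definable_over0/definable0_False. Qed.

Lemma definable_over_and P Γ (D E : set (tuple_in M Γ)) :
  definable_over P D -> definable_over P E -> definable_over P [set a | D a /\ E a].
Proof.
move=> hD hE; have := definable_over_not (definable_over_imp hD (definable_over_not hE)).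
congr definable_over; apply/seteqP; split=> a /=; last by case=> ha hb; apply.
by move=> h; split; apply: contrapT => n; apply: h => // hD' /n.
Qed.

Lemma definable_over_forall P Γ Δ (D : tuple_in M Γ -> tuple_in M Δ -> Prop) :
  @definable_over _ M P (Prod Γ Δ) [set a | D a.1 a.2] ->
  definable_over P [set a | forall b, D a b].
Proof.
move=> /definable_overP[Θ] [E] [c] [hE cP DE]; apply/definable_overP.
exists Θ, [set a : tuple_in M (Prod Γ Θ) | forall b, E ((a.1, b), a.2)], c; split=> //.
- apply: (@definable0_forall (Prod Γ Θ) Δ [set a | E ((a.1.1, a.2), a.1.2)]).
  apply: (@definable0_preimage (Prod (Prod Γ Θ) Δ) (Prod (Prod Γ Δ) Θ) (fun a => ((a.1.1, a.2), a.1.2)));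
    last exact: hE.
  solve_term_map.
- have {}DE a b : D a b <-> E ((a, b), c).
    by have /= := congr1 (fun S : set _ => S (a, b)) DE => ->.
  by apply/seteqP; split=> a h b; apply/DE; exact: h.
Qed.

Lemma definable_over_exists P Γ Δ (D : tuple_in M Γ -> tuple_in M Δ -> Prop) :
  @definable_over _ M P (Prod Γ Δ) [set a | D a.1 a.2] ->
  definable_over P [set a | exists b, D a b].
Proof.
move=> /definable_over_not hD.
have := definable_over_not (@definable_over_forall P Γ Δ (fun a b => ~ D a b) hD).
congr definable_over; apply/seteqP; split=> a /=; first by move/existsNP => -[b /contrapT]; exists b.
by case=> b Db /(_ b).
Qed.

Lemma definable_over_eq P Γ Δ (f g : tuple_in M Γ -> tuple_in M Δ) :
  term_map f -> term_map g -> definable_over P [set a | f a = g a].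
Proof.
move=> hf hg; apply: definable_over0.
exact: (definable0_preimage (term_map_pair hf hg) (definable0_eq Δ)).
Qed.

Lemma definable_over_fiber P Γ Δ (D : set (tuple_in M (Prod Γ Δ))) (b : tuple_in M Δ) :
  coords b `<=` P -> definable_over P D -> definable_over P [set a | D (a, b)].
Proof.
move=> bP /definable_overP[Θ] [E] [c] [hE cP ->]; apply/definable_overP.
exists (Prod Δ Θ), [set a : tuple_in M (Prod Γ (Prod Δ Θ)) | E ((a.1, a.2.1), a.2.2)], (b, c).
split=> //; last by rewrite coords_pair subUset.
apply: (@definable0_preimage (Prod Γ (Prod Δ Θ)) (Prod (Prod Γ Δ) Θ) (fun a => ((a.1, a.2.1), a.2.2)));
    last exact: hE.
solve_term_map.
Qed.

(** Each coordinate of [b] is a coordinate of [e] or a parameter from [P]. This turns a set defined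
    over [e] and [P] into a fibre of a [P]-definable family. *)
Lemma parameters_of_union P Γe Δ (e : tuple_in M Γe) (b : tuple_in M Δ) :
  coords b `<=` coords e `|` P ->
  exists Θ (p : tuple_in M Θ) (f : tuple_in M (Prod Γe Θ) -> tuple_in M Δ),
    [/\ coords p `<=` P, term_map f & f (e, p) = b].
Proof.
elim: Δ b => [|s|Δ1 IH1 Δ2 IH2] b.
- move=> _; exists Defs.Nil, tt, (fun=> tt); split; first by move=> ? [] [].
    exact: term_map_tt.
  by case: b.
- move=> /(_ (existT _ s b)) [].
  + by exists tt.
  + move=> [v _].
    (* The sort of the coordinate is tied to [v] by the equation; stating the claim for an arbitrary
       element [x] makes it possible to rewrite. *)
    suff parameter_of_coord (x : elt M) : existT _ (srt v) (lookup e v) = x ->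
        exists Θ (p : tuple_in M Θ)
          (f : tuple_in M (Prod Γe Θ) -> tuple_in M (One (projT1 x))),
        [/\ coords p `<=` P, term_map f & f (e, p) = projT2 x].
      exact: parameter_of_coord.
    move=> <- /=; exists Defs.Nil, tt, (fun a => lookup a.1 v); split=> //.
      by move=> ? [] [].
    exact: (term_map_comp (term_map_fst Γe Defs.Nil) (term_map_lookup v)).
  + move=> bP; exists (One s), b, (fun a => a.2); split=> //.
      by move=> _ [[] _ <-]; exact: bP.
    exact: term_map_snd.
- case: b => b1 b2; rewrite coords_pair subUset => -[/IH1 h1 /IH2 h2].
  have [Θ1 [p1 [f1 [p1P hf1 <-]]]] := h1; have [Θ2 [p2 [f2 [p2P hf2 <-]]]] := h2.
  exists (Prod Θ1 Θ2), (p1, p2), (fun a => (f1 (a.1, a.2.1), f2 (a.1, a.2.2))); split=> //.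
    by rewrite coords_pair subUset.
  solve_term_map.
Qed.

Lemma definable_over_union P Γ Γe (e : tuple_in M Γe) (D : set (tuple_in M Γ)) :
  definable_over (coords e `|` P) D ->
  exists2 E : set (tuple_in M (Prod Γ Γe)), definable_over P E & D = [set a | E (a, e)].
Proof.
move=> /definable_overP[Δ] [E] [b] [hE /parameters_of_union].
move=> -[Θ] [p] [f] [pP hf fE] ->.
exists [set a : tuple_in M (Prod Γ Γe) | E (a.1, f (a.2, p))]; last by rewrite -fE.
have h0 : definable0 [set a : tuple_in M (Prod (Prod Γ Γe) Θ) | E (a.1.1, f (a.1.2, a.2))].
  apply: (@definable0_preimage (Prod (Prod Γ Γe) Θ) (Prod Γ Δ) (fun a => (a.1.1, f (a.1.2, a.2))));
    last exact: hE.
  solve_term_map.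
exact: definable_over_fiber pP (definable_over0 P h0).
Qed.

End Definability.

Arguments definable0_False {L M} Γ.
Arguments definable0_eq {L M} Γ.

(** * Imaginaries over elements of the home sorts *)

Section Imaginaries.
Variables (L : signature) (M : structure L).
Implicit Types Γ Δ : ctx (eq_sort M).

(* An imaginary is represented by the tuples in its class. *)
Definition flat_sort (s : eq_sort M) : ctx (sorts L) :=
  match s with inl s => One s | inr e => im_ctx e end.

Definition unflatten_sort (s : eq_sort M) :
    tuple_in M (flat_sort s) -> carrier (eq_structure M) s :=
  match s with
  | inl _ => id
  | inr e => fun a => exist _ (im_class a) (ex_intro _ a erefl)
  end.

Fixpoint flat Γ : ctx (sorts L) :=
  match Γ with
  | Defs.Nil => Defs.Nil
  | One s => flat_sort s
  | Prod Γ Δ => Prod (flat Γ) (flat Δ)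
  end.

Fixpoint unflatten Γ : tuple_in M (flat Γ) -> tuple_in (eq_structure M) Γ :=
  match Γ return tuple_in M (flat Γ) -> tuple_in (eq_structure M) Γ with
  | Defs.Nil => id
  | One s => @unflatten_sort s
  | Prod Γ Δ => fun a => (unflatten a.1, unflatten a.2)
  end.

Lemma unflatten_sort_surj s (x : carrier (eq_structure M) s) :
  exists a, unflatten_sort a = x.
Proof.
case: s x => [s x|e [A Ax]]; first by exists x.
have [a Aa] := Ax; exists a; rewrite /=; subst A.
exact: eq_exist.
Qed.

Lemma unflatten_lookup Γ (v : var Γ) :
  exists2 f : tuple_in M (flat Γ) -> tuple_in M (flat_sort (srt v)),
    term_map f & forall a, unflatten_sort (f a) = lookup (unflatten a) v.
Proof.
elim: Γ v => [|s|Γ IH1 Δ IH2] v; first by case: v.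
- by exists id => //; exact: term_map_id.
- case: v => v.
  + have [f hf fE] := IH1 v; exists (fun a => f a.1) => //.
    exact: (term_map_comp (term_map_fst (flat Γ) (flat Δ)) hf).
  + have [f hf fE] := IH2 v; exists (fun a => f a.2) => //.
    exact: (term_map_comp (term_map_snd (flat Γ) (flat Δ)) hf).
Qed.

Definition liftable Γ s (t : term (L := eq_signature M) Γ s) : Prop :=
  exists2 f : tuple_in M (flat Γ) -> tuple_in M (flat_sort s),
    term_map f & forall a, unflatten_sort (f a) = eval (unflatten a) t.

Lemma liftable_args Γ (Θ : ctx (sorts L))
    (args : forall i : var (map_ctx (inl : _ -> eq_sort M) Θ),
       term (L := eq_signature M) Γ (srt i)) :
  (forall i, liftable (args i)) ->
  exists2 f : tuple_in M (flat Γ) -> tuple_in M Θ,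
    term_map f &
    forall a, f a = home_tuple (tabulate (fun i => eval (unflatten a) (args i))).
Proof.
elim: Θ args => [|s|Θ1 IH1 Θ2 IH2] args h.
- by exists (fun=> tt) => //; exact: term_map_tt.
- by have [f hf fE] := h tt; exists f => // a; rewrite -[LHS]/(unflatten_sort (s := inl s) (f a)) fE.
- have [f hf fE] := IH1 (fun i => args (inl i)) (fun i => h (inl i)).
  have [g hg gE] := IH2 (fun i => args (inr i)) (fun i => h (inr i)).
  exists (fun a => (f a, g a)); first exact: term_map_pair.
  by move=> a; rewrite fE gE.
Qed.

(** A function symbol of M lifts to itself and a quotient map to the identity, because a tuple
    represents its own class. *)
Lemma term_liftable Γ s (t : term (L := eq_signature M) Γ s) : liftable t.
Proof.
elim: t => [v|[f|e] args IH]; first exact: unflatten_lookup.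
- have [g hg gE] := liftable_args IH.
  exists (fun a => @fint _ M f (g a)); first exact: (term_map_comp hg (term_map_fint f)).
  by move=> a; rewrite gE.
- have [g hg gE] := liftable_args IH.
  by exists g => // a; rewrite gE.
Qed.

Lemma definable0_unflatten_eq s :
  @definable0 _ M (Prod (flat_sort s) (flat_sort s))
    [set a | unflatten_sort a.1 = unflatten_sort a.2].
Proof.
case: s => [s|e]; first exact: definable0_eq.
exists (im_rel e); apply/seteqP; split=> -[a b] /=.
  move=> /(congr1 (@proj1_sig _ _)) /= ab.
  by rewrite -[sat _ _]/(im_class a b) ab; exact: im_refl.
move=> ab; apply: eq_exist.
by apply/seteqP; split=> c; [apply/im_trans/im_sym|apply/im_trans].
Qed.

(** Formulas of M^eq are read on representatives: equality of classes becomes the defining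
    equivalence formula, and a quantifier over a sort becomes one over representatives, since every
    element has one. *)
Lemma definable0_unflatten Γ (φ : formula (L := eq_signature M) Γ) :
  definable0 [set a | @sat _ (eq_structure M) Γ φ (unflatten a)].
Proof.
elim: φ => [Θ|Θ s t u|Θ r args|Θ φ IH1 ψ IH2|Θ s φ IH].
- exact: definable0_False.
- have [f hf fE] := term_liftable t; have [g hg gE] := term_liftable u.
  have := definable0_preimage (term_map_pair hf hg) (definable0_unflatten_eq s).
  by congr definable0; apply/seteqP; split=> a /=; rewrite fE gE.
- have [f hf fE] := liftable_args (fun i => term_liftable (args i)).
  have hr : definable0 [set a | @rint _ M r a].
    by exists (Rel (fun i => Var i)); apply/seteqP; split=> a /=; rewrite tabulate_lookup.
  have := definable0_preimage hf hr.
  by congr definable0; apply/seteqP; split=> a /=; rewrite fE.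
- exact: definable0_imp.
- have := definable0_forall IH; congr definable0; apply/seteqP; split=> a h x.
    by have [b <-] := unflatten_sort_surj x; exact: h.
  exact: (h (unflatten_sort x)).
Qed.

(** Partial inverse of [to_eq]: it extracts an equality in M from one between dependent pairs, and
    rules out imaginary parameters. *)
Definition home_elt (e : elt (eq_structure M)) : option (elt M) :=
  match e with
  | existT (inl s) x => Some (existT _ s x)
  | existT (inr _) _ => None
  end.

Lemma home_params P Δ (b : tuple_in (eq_structure M) Δ) :
  coords b `<=` @to_eq L M @` P ->
  exists2 c : tuple_in M (flat Δ), coords c `<=` P & unflatten c = b.
Proof.
elim: Δ b => [|s|Δ1 IH1 Δ2 IH2] b bP.
- by exists b => // e [] [].
- have [e Pe eE] := bP _ (ex_intro2 _ _ (tt : var (One s)) I erefl).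
  case: s b eE bP => [s|i] b /(congr1 home_elt) //= /Some_inj eE _.
  exists b => // _ [[] _ <-].
  by have -> : existT _ s b = e by rewrite -eE; case: (e).
- case: b bP => b1 b2; rewrite coords_pair subUset => -[/IH1[c1 c1P c1E] /IH2[c2 c2P c2E]].
  exists (c1, c2); first by rewrite coords_pair subUset.
  by rewrite /= c1E c2E.
Qed.

(** The parameters are home elements, so the formula of M^eq witnessing algebraicity translates back
    to M and defines the same finite set. *)
Lemma acl_home P s (x : carrier M s) :
  acl (@to_eq L M @` P) (to_eq (existT _ s x)) ->
  exists D, [/\ @definable_over _ M P (One s) D, finite_set D & D x].
Proof.
move=> [D [] [Δ] [φ] [b] [/home_params[c cP <-] DE] Dfin Dx].
exists D; split=> //; apply/definable_overP.
exists (flat Δ), [set a | sat φ (unflatten (Γ := Prod (One (inl s)) Δ) a)], c.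
split=> //; first exact: (definable0_unflatten φ).
Qed.

End Imaginaries.

(** * Finite-to-finite correspondences *)

(** [{classic T}] gives an arbitrary type a boolean equality, so that finite sets can be counted
    through sequences. *)
Lemma card_le_seqP (T : Type) (A : set T) k :
  A #<= `I_k <-> exists2 s : seq {classic T}, (size s <= k)%N & A `<=` [set` s].
Proof.
split=> [Ak|[s sk sA]].
  exists (enum_fset (fset_set (A : set {classic T}))); first exact: geq_card_fset_set.
  have Afin : finite_set (A : set {classic T}) by apply/finite_set_leP; exists k.
  by move=> x Ax /=; rewrite in_fset_set // inE.
have sfin : finite_set [set` s] by exact: finite_seq.
have /finite_setP[m sm] := sfin.
have mk : (m <= k)%N.
  rewrite -(card_fset_set sm); apply: leq_trans sk.
  by apply: uniq_leq_size => // x; rewrite in_fset_set // inE.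
apply: (card_le_trans (subset_card_le sA)).
by rewrite (card_le_eql sm) card_le_II.
Qed.

Lemma size_le_card (T : eqType) (A : set T) (s : seq T) k :
  uniq s -> [set` s] `<=` A -> A #<= `I_k -> (size s <= k)%N.
Proof.
move=> us sA /card_le_seqP[t tk At]; apply: leq_trans tk.
rewrite -(size_map (id : T -> {classic T})); apply: uniq_leq_size.
  by rewrite map_inj_uniq.
by move=> _ /mapP[x xs ->]; exact: (At x (sA x xs)).
Qed.

Lemma card_le_size (T : eqType) (s : seq T) : [set` s] #<= `I_(size s).
Proof.
apply/card_le_seqP; exists (s : seq {classic T}) => // x /=.
elim: s => //= y s IH; rewrite inE => /orP[/eqP ->|/IH xs]; first exact: mem_head.
by rewrite inE xs orbT.
Qed.

Lemma card_le_bigcup (I T : Type) (A : set I) (B : I -> set T) k l :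
  A #<= `I_k -> (forall i, A i -> B i #<= `I_l) ->
  \bigcup_(i in A) B i #<= `I_(k * l).
Proof.
move=> /card_le_seqP[s sk As] Bl.
have /choice[t tP] (i : {classic I}) : exists t : seq {classic T},
    A i -> (size t <= l)%N /\ B i `<=` [set` t].
  have [Ai|nAi] := pselect (A i); last by exists [::].
  by have /card_le_seqP[t tl Bt] := Bl i Ai; exists t.
(* [t i] is short only for [i] in [A], and [s] may contain other indices, hence the filter. *)
apply/card_le_seqP; exists (flatten [seq t i | i <- s & `[< A i >]]).
  apply: (@leq_trans (size [seq i <- s | `[< A i >]] * l)%N); last first.
    by rewrite leq_mul2r (leq_trans _ sk) ?orbT // size_filter count_size.
  elim: s {sk As} => //= i s IH; case: ifP => [/asboolP/tP[til _]|_] //=.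
  by rewrite size_cat mulSn leq_add.
move=> x [i Ai Bix] /=; apply/flatten_mapP; exists i.
  by rewrite mem_filter; apply/andP; split; [apply/asboolP|exact: As].
by have [_] := tP i Ai; exact.
Qed.

Lemma card_le_image_II (I T : Type) (A : set I) (f : I -> T) k :
  A #<= `I_k -> f @` A #<= `I_k.
Proof. exact/card_le_trans/card_image_le. Qed.

Lemma card_le_preimage (T U : Type) (f : T -> U) (A : set U) k :
  injective f -> A #<= `I_k -> [set x | A (f x)] #<= `I_k.
Proof.
move=> finj Ak; rewrite -(card_le_eql (inj_card_eq (f := f) _)); last by move=> x y _ _ /finj.
by apply: card_le_trans Ak; apply: subset_card_le => _ [x Ax <-].
Qed.

(** A recursion on the bound that uses only quantifiers and equality, so that cardinality bounds can
    be written into formulas. *)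
Lemma card_le_setD1P (T : Type) (A : set T) k :
  A #<= `I_k.+1 <-> forall x, A x -> A `\ x #<= `I_k.
Proof.
split=> [/card_le_seqP[s sk As] x Ax|h].
  apply/card_le_seqP; exists (rem (x : {classic T}) s).
    by rewrite size_rem; [case: (size s) sk | exact: As].
  move=> y [Ay yx] /=; have := As y Ay; rewrite /= (perm_mem (perm_to_rem (As x Ax))).
  by rewrite inE => /orP[/eqP|].
have [->|/set0P[x Ax]] := eqVneq A set0; first exact: card_ge0.
have /card_le_seqP[s sk As] := h x Ax.
apply/card_le_seqP; exists ((x : {classic T}) :: s) => // y Ay /=.
rewrite inE; have [->|yx] := pselect (y = x); first by rewrite eqxx.
by apply/orP; right; exact: (As y).
Qed.

(** * Definable families with uniformly finite fibres *)

Section Families.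
Variables (L : signature) (M : structure L).
Implicit Types (Γ Δ : ctx (sorts L)) (P : set (elt M)).

Lemma definable_over_card_le P Γ Δ (D : tuple_in M Γ -> set (tuple_in M Δ)) k :
  @definable_over _ M P (Prod Γ Δ) [set a | D a.1 a.2] ->
  definable_over P [set a | D a #<= `I_k].
Proof.
elim: k Γ D => [|k IH] Γ D hD.
  have := definable_over_forall (D := fun a b => ~ D a b) (definable_over_not hD).
  congr definable_over; apply/seteqP; split=> a /=; rewrite II0 card_le0.
    by move=> h; apply/eqP/seteqP; split=> x // /h.
  by move/eqP => -> b.
have hE : definable_over P [set a : tuple_in M (Prod (Prod Γ Δ) Δ) |
    D a.1.1 a.2 /\ ~ (a.2 = a.1.2)].
  apply: definable_over_and.
  - apply: (@definable_over_preimage _ _ _ (Prod (Prod Γ Δ) Δ) (Prod Γ Δ)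
      (fun a => (a.1.1, a.2))) hD.
    solve_term_map.
  - apply: definable_over_not.
    by apply: (@definable_over_eq L M P (Prod (Prod Γ Δ) Δ) Δ (fun a => a.2)
      (fun a => a.1.2)); solve_term_map.
have := definable_over_forall (D := fun a b => D a b -> D a `\ b #<= `I_k)
  (definable_over_imp hD (IH (Prod Γ Δ) (fun a => D a.1 `\ a.2) hE)).
by congr definable_over; apply/seteqP; split=> a /card_le_setD1P.
Qed.

(* A finite fibre over [e] of a P-definable relation has some cardinal N; the *)
(* fibres over all other points are bounded by putting "at most N solutions"  *)
(* into the formula.                                                          *)
Lemma algebraic_family P Γ Γe (a : tuple_in M Γ) (e : tuple_in M Γe) :
  algebraic_over (coords e `|` P) a ->
  exists N (R : set (tuple_in M (Prod Γ Γe))),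
    [/\ definable_over P R, R (a, e) & forall e', [set a' | R (a', e')] #<= `I_N].
Proof.
rewrite /algebraic_over; elim: Γ a => [|s|Γ1 IH1 Γ2 IH2] a alg.
- exists 1%N, [set b | ~ False]; split=> //.
    exact/definable_over0/definable0_not/definable0_False.
  move=> e'; apply/card_le_seqP; exists [:: tt : {classic unit}] => // -[] _ /=.
  by rewrite inE.
- have /acl_home[D [hD /finite_set_leP[N DN] Da]] := alg _ (imageP _ (ex_intro2 _ _ (tt : var (One s)) I erefl)).
  have [E hE DE] := definable_over_union hD.
  exists N, [set b : tuple_in M (Prod (One s) Γe) | E b /\ [set c | E (c, b.2)] #<= `I_N].
  split.
  + apply: definable_over_and; first exact: hE.
    have tm : @term_map _ M (Prod (Prod (One s) Γe) (One s)) (Prod (One s) Γe) (fun b => (b.2, b.1.2)).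
      solve_term_map.
    apply: (@definable_over_card_le P (Prod (One s) Γe) (One s) (fun b c => E (c, b.2))).
    exact: (definable_over_preimage tm hE).
  + by move: Da DN; rewrite DE; split.
  + move=> e'; have [[c [_ h]]|h] := pselect (exists c, E (c, e') /\ [set c | E (c, e')] #<= `I_N).
      by apply: card_le_trans h; apply: subset_card_le => x [].
    rewrite [X in X #<= _](_ : _ = set0); first exact: card_ge0.
    by apply/seteqP; split=> c //= hc; case: h; exists c.
- case: a alg => a1 a2; rewrite coords_pair image_setU subUset.
  move=> -[/IH1[N1 [R1 [hR1 R1a R1N]]] /IH2[N2 [R2 [hR2 R2a R2N]]]].
  exists (N1 * N2)%N, [set b : tuple_in M (Prod (Prod Γ1 Γ2) Γe) | R1 (b.1.1, b.2) /\ R2 (b.1.2, b.2)].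
  split=> //.
  + apply: definable_over_and.
    * have tm : @term_map _ M (Prod (Prod Γ1 Γ2) Γe) (Prod Γ1 Γe) (fun b => (b.1.1, b.2)).
        solve_term_map.
      exact: (definable_over_preimage tm hR1).
    * have tm : @term_map _ M (Prod (Prod Γ1 Γ2) Γe) (Prod Γ2 Γe) (fun b => (b.1.2, b.2)).
        solve_term_map.
      exact: (definable_over_preimage tm hR2).
  + move=> e'; apply: card_le_trans (card_le_bigcup (R1N e')
      (fun x _ => card_le_image_II (fun y => (x, y)) (R2N e'))).
    by apply: subset_card_le => -[x y] /= [hx hy]; exists x => //; exists y.
Qed.

Lemma interalgebraic_family P Γ Δ (a : tuple_in M Γ) (b : tuple_in M Δ) :
  interalgebraic_over P a b ->
  exists N (R : tuple_in M Γ -> tuple_in M Δ -> Prop),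
    [/\ @definable_over _ M P (Prod Γ Δ) [set x | R x.1 x.2], R a b,
        forall x, [set y | R x y] #<= `I_N & forall y, [set x | R x y] #<= `I_N].
Proof.
move=> [/algebraic_family[N1 [R1 [hR1 R1a R1N]]] /algebraic_family[N2 [R2 [hR2 R2a R2N]]]].
exists (maxn N1 N2), (fun x y => R1 (x, y) /\ R2 (y, x)); split=> //.
- apply: definable_over_and.
    by rewrite [X in definable_over _ X](_ : _ = R1) //; apply/seteqP; split=> -[].
  have tm : @term_map _ M (Prod Γ Δ) (Prod Δ Γ) (fun b => (b.2, b.1)).
    solve_term_map.
  exact: (definable_over_preimage tm hR2).
- move=> x; apply: card_le_trans (subset_card_le _) _; last first.
    apply: card_le_trans (R2N x) _; rewrite card_le_II; exact: leq_maxr.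
  by move=> y [].
- move=> y; apply: card_le_trans (subset_card_le _) _; last first.
    apply: card_le_trans (R1N y) _; rewrite card_le_II; exact: leq_maxl.
  by move=> x [].
Qed.

End Families.

(** * Sets of small doubling in minimal groups *)

Section MinimalGroup.
Variable G : groupType.
Local Open Scope group_scope.

Definition centralizer (a : G) : set G := [set x | commute a x].
(** Conjugates of [a], written without inverses so that the graph of multiplication defines the
    class directly. *)
Definition conj_class (a : G) : set G := [set x | exists y, y * x = a * y].

Hypothesis G_infinite : infinite_set [set: G].
Hypothesis centralizer_minimal : forall a,
  finite_set (centralizer a) \/ finite_set (~` centralizer a).
Hypothesis conj_class_minimal : forall a,
  finite_set (conj_class a) \/ finite_set (~` conj_class a).

Definition noncentral (a : G) : Prop := exists x, ~ commute a x.

Lemma cofinite_nonempty (A : set G) : finite_set (~` A) -> exists x, A x.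
Proof.
move=> Afin; apply: contrapT => h; apply: G_infinite.
by apply: sub_finite_set Afin => x _ Ax; apply: h; exists x.
Qed.

Lemma finite_translate (A : set G) (g : G) : finite_set A -> finite_set [set x | A (g * x)].
Proof.
move=> Afin; apply: (@sub_finite_set _ _ ((fun x => g^-1 * x) @` A)).
  by move=> x Agx; exists (g * x) => //; rewrite mulKg.
exact: finite_image.
Qed.

(** A cofinite centralizer contains both x and g x for some x, hence g, whatever g is. *)
Lemma noncentral_centralizer a : noncentral a -> finite_set (centralizer a).
Proof.
move=> [g ng]; have [//|Cfin] := centralizer_minimal a.
have /cofinite_nonempty[x [Cx Cgx]] :
    finite_set (~` (centralizer a `&` [set x | centralizer a (g * x)])).
  rewrite setCI finite_setU; split=> //.
  exact: (@finite_translate (~` centralizer a)).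
case: ng; have := commuteM Cgx (commuteV Cx).
by rewrite mulgK.
Qed.

(** The elements conjugating [a] to a given x lie in one coset of the finite centralizer; a finite
    class would make G finite. *)
Lemma noncentral_class a : noncentral a -> finite_set (~` conj_class a).
Proof.
move=> nca; have [Kfin|//] := conj_class_minimal a; case: G_infinite.
pose fib x : set G := [set y | y * x = a * y].
have fib_fin x : finite_set (fib x).
  have [[y0 y0x]|nofib] := pselect (exists y0, fib x y0); last first.
    by apply: (@sub_finite_set _ _ set0) => // y hy; case: nofib; exists y.
  apply: (@sub_finite_set _ _ ((fun c => c * y0) @` centralizer a)).
    move=> y hy; exists (y * y0^-1); last by rewrite mulgVK.
    rewrite /centralizer /= /commute mulgA -hy -!mulgA; congr (_ * _).
    by apply: (mulIg y0); rewrite mulgVK -mulgA -y0x mulKg.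
  exact/finite_image/noncentral_centralizer.
apply: (@sub_finite_set _ _ (\bigcup_(x in conj_class a) fib x)).
  move=> y _; exists (y^-1 * (a * y)); last by rewrite /fib /= mulVKg.
  by exists y; rewrite mulVKg.
exact: bigcup_finite.
Qed.

(** Two cofinite classes meet. *)
Lemma noncentral_conj a b : noncentral a -> noncentral b -> exists y, y * b = a * y.
Proof.
move=> /noncentral_class Ka /noncentral_class Kb.
have /cofinite_nonempty[x [[y ya] [z zb]]] :
  finite_set (~` (conj_class a `&` conj_class b)) by rewrite setCI finite_setU.
exists (y * z^-1).
have -> : b = z * x * z^-1 by rewrite zb mulgK.
by rewrite !mulgA mulgVK -ya.
Qed.

(* All noncentral elements are conjugate, so some y conjugates a to its       *)
(* inverse and y^2 commutes with a.  Let m be the order of y modulo the       *)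
(* centre.  If m is odd, y commutes with a and a^2 = 1; if m is even, y^(m/2) *)
(* is the required element.                                                   *)
Lemma noncentral_central_square a :
  (forall x : G, exists2 n, (0 < n)%N & x ^+ n = 1) ->
  noncentral a -> exists2 b, noncentral b & ~ noncentral (b ^+ 2).
Proof.
move=> tors nca.
have ncaV : noncentral a^-1.
  case: nca => g ng; exists g => cg; apply: ng.
  by apply: commute_sym; rewrite -(invgK a); apply/commuteV/commute_sym.
have [y ya] := noncentral_conj nca ncaV.
have ya' : y * a = a^-1 * y.
  by apply: (mulgI a); rewrite mulVKg mulgA -ya mulgVK.
(* Since y conjugates a to its inverse, commuting with a forces a^2 = 1, and a itself is the
   witness. *)
have involution : commute a y -> exists2 b, noncentral b & ~ noncentral (b ^+ 2).
  move=> cay; exists a => //.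
  suff -> : a ^+ 2 = 1 by case=> x; apply; exact/commute_sym/commute1.
  by apply: (mulIg y); rewrite mul1g expg2 -mulgA -ya mulgA cay mulgK.
have [cay|nay] := pselect (commute a y); first exact: involution.
have ncy : noncentral y by exists a => /commute_sym.
have cy2 : commute a (y ^+ 2).
  by rewrite /commute expg2 mulgA -ya -mulgA -ya' mulgA.
pose central n := (0 < n)%N && `[< ~ noncentral (y ^+ n) >].
have exn : exists n, central n.
  have [n n0 yn] := tors y; exists n; rewrite /central n0; apply/asboolP.
  by rewrite yn; case=> x; apply; exact/commute_sym/commute1.
have [m /andP[m0 /asboolP mP] mmin] := find_ex_minn exn.
case: (boolP (odd m)) => modd.
  apply: involution.
  have cm : commute a (y ^+ m).
    by apply: commute_sym; apply: contrapT => h; apply: mP; exists a.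
  (* For odd m, y is y^m times a power of y^2, both of which commute with a. *)
  have := commuteM cm (commuteV (commuteX (m./2) cy2)).
  by rewrite -expgnA mul2n -{1}(odd_double_half m) modd expgnDr mulgK expg1.
exists (y ^+ m./2); last by rewrite -expgnA muln2 halfK (negbTE modd) subn0.
apply: contrapT => h.
have := mmin m./2; rewrite /central half_gt0.
have m1 : (1 < m)%N by case: (m) m0 modd => [|[]].
rewrite m1 /= => /(_ (asboolT h)); rewrite leqNgt.
by rewrite ltn_half_double -addnn -[X in (X < _)%N]addn0 ltn_add2l m0.
Qed.

(* The torsion case of Reineke's theorem.  Cofinitely many t are conjugate to *)
(* b together with b t, so that t^2 = (b t)^2 = b^2; such t invert b, and the *)
(* quotient of two of them centralizes b.                                     *)
Lemma torsion_abelian :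
  (forall x : G, exists2 n, (0 < n)%N & x ^+ n = 1) -> forall x y : G, commute x y.
Proof.
move=> tors x y; apply: contrapT => nxy.
have [b ncb cb2] := noncentral_central_square tors (ex_intro _ y nxy : noncentral x).
have b2C w : commute (b ^+ 2) w by apply: contrapT => h; apply: cb2; exists w.
have class_sq w : conj_class b w -> w ^+ 2 = b ^+ 2.
  move=> [v vw]; apply: (mulgI v); rewrite -b2C !expg2 mulgA vw -!mulgA vw.
  by [].
pose T := [set t | conj_class b t /\ conj_class b (b * t)].
have Tcofin : finite_set (~` T).
  rewrite [X in ~` X](_ : T = conj_class b `&` [set t | conj_class b (b * t)]) //.
  rewrite setCI finite_setU; split; first exact: noncentral_class.
  exact: (@finite_translate (~` conj_class b) b (noncentral_class ncb)).
have Tinv t : T t -> t * b = b^-1 * t.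
  move=> [/class_sq t2 /class_sq bt2].
  apply: (mulgI b); rewrite mulVKg; apply: (mulIg t).
  by rewrite -[RHS]expg2 t2 -bt2 expg2 !mulgA.
have [t0 /Tinv t0P] := cofinite_nonempty Tcofin.
apply: G_infinite; rewrite -(setvU T) finite_setU; split=> //.
apply: (@sub_finite_set _ _ ((fun c => c * t0) @` centralizer b)); last first.
  exact/finite_image/noncentral_centralizer.
move=> t /Tinv tP; exists (t * t0^-1); last by rewrite mulgVK.
rewrite /centralizer /= /commute; apply: (mulIg t0).
have swap u : u * b = b^-1 * u -> b * u = u * b^-1.
  by move=> uP; apply: (mulIg b); rewrite mulgVK -mulgA uP mulVKg.
rewrite mulgA mulgVK (swap _ tP) -!mulgA; congr (_ * _).
by apply: (mulgI t0); rewrite mulVKg (swap _ t0P).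
Qed.

(* A set s with |s s| <= 2 |s|: a progression h^i if some h has infinite *)
(* order, and a finite subgroup otherwise.                               *)
Lemma small_doubling N : exists s t : seq G,
  [/\ uniq s, (N <= size s)%N, (size t <= 2 * size s)%N
    & forall x y, x \in s -> y \in s -> x * y \in t].
Proof.
have [tors|/existsNP[h hinf]] :=
    pselect (forall x : G, exists2 n, (0 < n)%N & x ^+ n = 1); last first.
  exists [seq h ^+ i | i <- iota 0 N], [seq h ^+ i | i <- iota 0 (2 * N)].
  split; rewrite ?size_map ?size_iota //.
    rewrite map_inj_uniq ?iota_uniq //.
    have inj i j : (i <= j)%N -> h ^+ i = h ^+ j -> i = j.
      move=> ij hij; apply/eqP; rewrite eqn_leq ij /= -subn_eq0.
      apply: contrapT => /negP; rewrite -lt0n => ji; apply: hinf; exists (j - i)%N => //.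
      by rewrite expgnFr // hij mulgV.
    move=> i j; have [ij|/ltnW ji] := leqP i j; first exact: inj.
    by move/esym/inj => ->.
  move=> _ _ /mapP[i iN ->] /mapP[j jN ->]; rewrite -expgnDr map_f //.
  move: iN jN; rewrite !mem_iota /= !add0n => iN jN.
  by rewrite mul2n -addnn; apply: (@leq_trans (N + j)%N); rewrite ?ltn_add2r ?leq_add2l ?(ltnW jN).
have comm := torsion_abelian tors.
suff [s [us sN s1 sM]] : exists s : seq G, [/\ uniq s, (N <= size s)%N, 1 \in s
    & forall x y, x \in s -> y \in s -> x * y \in s].
  by exists s, s; split=> //; rewrite leq_pmull.
(* A finite submonoid s of the abelian torsion group is enlarged by an outside element h with h^n =
   1: the products x h^i with x in s and i < n are again closed under multiplication. *)
elim: N => [|N [s [us sN s1 sM]]].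
  exists [:: 1]; split=> //; first exact: mem_head.
  by move=> x y; rewrite !inE => /eqP -> /eqP ->; rewrite mulg1.
have [h hs] : exists h, h \notin s.
  apply: contrapT => nh; apply: G_infinite.
  apply: (@sub_finite_set _ _ [set` s]); last exact: finite_seq.
  by move=> h _ /=; apply: contrapT => /negP hs; apply: nh; exists h.
have [n n0 hn] := tors h.
pose t := undup [seq x * h ^+ i | x <- s, i <- iota 0 n].
have tP x i : x \in s -> x * h ^+ i \in t.
  move=> xs; rewrite mem_undup; apply/allpairsP; exists (x, (i %% n)%N); split=> //=.
    by rewrite mem_iota /= add0n ltn_pmod.
  by rewrite {1}(divn_eq i n) expgnDr mulnC expgnA hn expg1n mul1g.
exists t; split.
- exact: undup_uniq.
- apply: leq_ltn_trans sN _.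
  apply: (@uniq_leq_size _ (h :: s)); first by rewrite /= hs.
  move=> x; rewrite inE => /orP[/eqP ->|xs].
    by rewrite -[h]mul1g -[X in 1 * X]expg1 tP.
  by rewrite -[x]mulg1 -[X in x * X](expg0 h) tP.
- by rewrite -[1](mulg1 1) -[X in 1 * X](expg0 h) tP.
- move=> x0 y0; rewrite mem_undup => /allpairsP[[x i] /= [xs _ ->]].
  rewrite mem_undup => /allpairsP[[y j] /= [ys _ ->]].
  have -> : x * h ^+ i * (y * h ^+ j) = x * y * h ^+ (i + j).
    by rewrite expgnDr -!mulgA; congr (_ * _); rewrite !mulgA (comm y).
  exact/tP/sM.
Qed.

End MinimalGroup.

(** * Morley rank *)

Section MorleyRank.
Variables (L : signature) (M : structure L).
Implicit Types (Γ Δ : ctx (sorts L)).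

Lemma definable_overT P Γ (D : set (tuple_in M Γ)) : definable_over P D -> definable D.
Proof. exact: definable_overS (@subsetT _ _). Qed.

Lemma definable_over_image P Γ Δ (f : tuple_in M Γ -> tuple_in M Δ)
    (D : set (tuple_in M Γ)) :
  term_map f -> definable_over P D -> definable_over P (f @` D).
Proof.
move=> hf hD.
have -> : f @` D = [set x | exists a, D a /\ f a = x].
  by apply/seteqP; split=> x [a]; [exists a|case; exists a].
apply: definable_over_exists; apply: definable_over_and.
  exact: definable_over_preimage (term_map_snd _ _) hD.
apply: definable_over_eq; last exact: term_map_fst.
exact: term_map_comp (term_map_snd _ _) hf.
Qed.

Lemma definable_set1 Γ (a : tuple_in M Γ) : definable [set a].
Proof.
exact: (@definable_over_fiber _ _ _ Γ Γ _ a (@subsetT _ _) (definable_over0 _ (definable0_eq Γ))).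
Qed.

Lemma definable_setD Γ (D E : set (tuple_in M Γ)) :
  definable D -> definable E -> definable (D `\` E).
Proof. by move=> hD /definable_over_not; exact: definable_over_and. Qed.

Lemma RM_ge_sub Γ n (D E : set (tuple_in M Γ)) : D `<=` E -> RM_ge n D -> RM_ge n E.
Proof.
case: n => [|n] DE; first by case=> x /DE; exists x.
move=> [A [hA tA]]; exists A; split=> // i; have [dA sA rA] := hA i.
by split=> //; exact: subset_trans DE.
Qed.

Lemma RM_geW Γ n (D : set (tuple_in M Γ)) : RM_ge n.+1 D -> RM_ge n D.
Proof. by move=> [A [hA _]]; have [_ sA] := hA 0%N; exact: RM_ge_sub. Qed.

Lemma RM_ge_leq Γ m n (D : set (tuple_in M Γ)) : (m <= n)%N -> RM_ge n D -> RM_ge m D.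
Proof.
by move=> /subnK <-; elim: (n - m)%N => // k IH /RM_geW.
Qed.

Lemma has_RM_uniq Γ m n (D : set (tuple_in M Γ)) : has_RM D m -> has_RM D n -> m = n.
Proof.
move=> [rm nm] [rn nn]; case: (ltngtP m n) => // mn; exfalso.
  by apply: nm; apply: RM_ge_leq rn.
by apply: nn; apply: RM_ge_leq rm.
Qed.

Lemma injective_seq_infinite (T : Type) (D : set T) (f : nat -> T) :
  injective f -> (forall i, D (f i)) -> infinite_set D.
Proof.
move=> finj fD Dfin; apply: infinite_nat.
have : finite_set (f @` setT) by apply: sub_finite_set Dfin => _ [i _ <-].
by rewrite (eq_finite_set (inj_card_eq _)) // => i j _ _ /finj.
Qed.

Lemma infinite_injective_seq (T : Type) (D : set T) :
  infinite_set D -> exists f : nat -> T, injective f /\ forall i, D (f i).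
Proof.
elim/Ppointed: T => T in D *; first by rewrite emptyE => /(_ (finite_set0 T)).
move=> /infiniteP/pcard_leP[f]; exists f; split=> [i j fij|i]; last exact: funS.
by apply: (inj (f := f)) fij; rewrite inE.
Qed.

Lemma RM_ge1P Γ (D : set (tuple_in M Γ)) : RM_ge 1 D <-> infinite_set D.
Proof.
split=> [[A [hA tA]]|/infinite_injective_seq[f [finj fD]]].
  have /choice[x xA] i : exists x, A i x by have [_ _] := hA i.
  apply: (@injective_seq_infinite _ _ x) => [i j xij|i].
    by apply: (tA i j) => //; exists (x i); split=> //; rewrite xij.
  by have [_ sA _] := hA i; exact/sA.
exists (fun i => [set f i]); split=> [i|i j _ _ [_ [-> /finj]]] //.
by split; [exact: definable_set1|move=> _ ->|exists (f i)].
Qed.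

Lemma RM_ge2_fibers Γ Δ (D : set (tuple_in M Γ)) (f : tuple_in M Γ -> tuple_in M Δ)
    (J : set (tuple_in M Δ)) :
  definable D -> term_map f -> infinite_set J ->
  (forall v, J v -> infinite_set [set a | D a /\ f a = v]) -> RM_ge 2 D.
Proof.
move=> hD hf /infinite_injective_seq[v [vinj vJ]] hfib.
exists (fun i => [set a | D a /\ f a = v i]); split=> [i|i j _ _ [a [[_ fi] [_ fj]]]]; last first.
  by apply: vinj; rewrite -fi.
split; [|by move=> a []|exact/RM_ge1P/hfib].
by apply: definable_over_and => //; exact: (definable_over_preimage hf (definable_set1 (v i))).
Qed.

(** [E] and its complement in [D] would witness degree at least 2. *)
Lemma degree1_indecomposable Γ n (D E : set (tuple_in M Γ)) :
  definable D -> has_RM D n -> has_MD D 1 -> definable E -> E `<=` D ->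
  RM_ge n E -> RM_ge n (D `\` E) -> False.
Proof.
move=> hD rD [m [rD' _ nD]] hE ED rE rDE.
rewrite (has_RM_uniq rD' rD) in nD; apply: nD.
have no D' : D' `<=` D -> ~ RM_ge n.+1 D' by move=> sD /(RM_ge_sub sD); case: rD.
exists (fun i : 'I_2 => if i == ord0 then E else D `\` E); split=> [i|].
  by case: ifP => _; split=> //; try (split=> //; exact: no); exact: definable_setD.
move=> i j _ _ [a []]; case: ifP => [/eqP ->|i0]; case: ifP => [/eqP ->|j0] //.
- by move=> Ea [].
- by move=> [].
- move=> _ _; apply/val_inj; move: i0 j0.
  by case: i => -[|[|]] //= ?; case: j => -[|[|]].
Qed.

Lemma rank1_minimal Γ (D E : set (tuple_in M Γ)) :
  definable D -> has_RM D 1 -> has_MD D 1 -> definable E -> E `<=` D ->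
  finite_set E \/ finite_set (D `\` E).
Proof.
move=> hD rD mD hE ED; apply: contrapT => /not_orP[/RM_ge1P Einf /RM_ge1P DEinf].
exact: (degree1_indecomposable hD rD mD hE ED).
Qed.

(** Each of the disjoint infinite sets [E i] has infinite, hence cofinite, image in [X]. So N + 1 of
    the images share a point, whose fibre then has N + 1 elements. *)
Lemma bounded_to_one_RM Γ Δ (W : set (tuple_in M Γ)) (f : tuple_in M Γ -> tuple_in M Δ)
    (X : set (tuple_in M Δ)) N :
  strongly_minimal X -> term_map f -> (forall a, W a -> X (f a)) ->
  (forall x, [set a | W a /\ f a = x] #<= `I_N) -> ~ RM_ge 2 W.
Proof.
move=> [_ Xinf Xmin] hf WX Wfib [E [hE tE]].
have cofin i : finite_set (X `\` f @` E i).
  have [dE sE /RM_ge1P Einf] := hE i.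
  have [|||//] := Xmin (f @` E i); last move=> fin.
  - exact: definable_over_image.
  - by move=> _ [a /sE/WX Xa <-].
  - case: Einf; apply: (@sub_finite_set _ _ (\bigcup_(x in f @` E i) [set a | W a /\ f a = x])).
      by move=> a Ea; exists (f a); [exists a|split=> //; exact: sE].
    by apply: bigcup_finite => // x _; apply/finite_set_leP; exists N.
have [x Xx] : exists x, forall i, (i < N.+1)%N -> (f @` E i) x.
  apply: contrapT => nx; apply: Xinf.
  apply: (@sub_finite_set _ _ (\bigcup_(i in `I_N.+1) (X `\` f @` E i))).
    move=> x Xx; apply: contrapT => h; apply: nx; exists x => i iN.
    by apply: contrapT => nE; apply: h; exists i.
  by apply: bigcup_finite => //; exact: finite_II.
have /choice[a aP] i : exists a, (i < N.+1)%N -> E i a /\ f a = x.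
  have [iN|] := ltnP i N.+1; last by have [a _ _] := Xx 0%N isT; exists a.
  by have [a Ea fa] := Xx i iN; exists a.
suff : (size [seq a i | i <- iota 0 N.+1] <= N)%N by rewrite size_map size_iota ltnn.
apply: (@size_le_card {classic tuple_in M Γ} [set a | W a /\ f a = x]); last exact: Wfib.
  rewrite map_inj_in_uniq ?iota_uniq // => i j.
  rewrite !mem_iota !add0n /= => /aP[Ei _] /aP[Ej _] aij.
  by apply: (tE i j) => //; exists (a i); split=> //; rewrite aij.
move=> b /mapP[i]; rewrite mem_iota add0n /= => iN ->.
by have [Ei <-] := aP i iN; have [_ sE _] := hE i; split=> //; exact: sE.
Qed.

End MorleyRank.

(** * Grids *)

Section Counting.
Import Order.TTheory GRing.Theory Num.Theory.
Local Open Scope ring_scope.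
Variable R : realType.

Lemma powR_sub_lt_square (eps k : R) : 0 < eps ->
  exists n0 : nat, forall n, (n0 < n)%N -> k * n%:R `^ (2 - eps) < n%:R ^+ 2.
Proof.
(* The threshold K^(1/eps) makes n^eps exceed k; the maximum with 1 keeps the base positive. *)
move=> eps0; pose K := Num.max k 1.
have K0 : 0 < K by rewrite lt_max ltr01 orbT.
exists (Num.bound (K `^ eps^-1)) => n n0n.
have Kn : K `^ eps^-1 < n%:R.
  apply: lt_le_trans (archi_boundP (powR_ge0 _ _)) _.
  by rewrite ler_nat ltnW.
have n0 : 0 < n%:R :> R by apply: le_lt_trans Kn; exact: powR_ge0.
have kn : k < n%:R `^ eps.
  have : (K `^ eps^-1) `^ eps < n%:R `^ eps.
    by apply: gt0_ltr_powR => //; rewrite nnegrE ?powR_ge0 // ltW.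
  rewrite -powRrM mulVf ?gt_eqF // powRr1 ?ltW //; apply: le_lt_trans.
  by rewrite /K le_max lexx.
have -> : n%:R ^+ 2 = n%:R `^ (2 - eps) * n%:R `^ eps :> R.
  by rewrite -(powR_mulrn _ (ltW n0)) -powRD ?subrK // [n%:R == 0]gt_eqF ?implybT.
by rewrite mulrC ltr_pM2l // powR_gt0.
Qed.

Lemma size_grid_le (U V W : Type) (f : U -> V -> W) (D : set W)
    (s : seq {classic U}) (t : seq {classic V}) q :
  (forall u v u' v', f u v = f u' v' -> u = u' /\ v = v') ->
  uniq s -> uniq t -> (forall u v, u \in s -> v \in t -> D (f u v)) ->
  D #<= `I_q -> (size s * size t <= q)%N.
Proof.
pose g : {classic U} -> {classic V} -> {classic W} := f.
move=> finj us ut sub Dq; rewrite -(size_allpairs g).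
apply: (@size_le_card {classic W} D) => //.
  by apply: (@allpairs_uniq _ _ _ g) => // -[u v] [u' v'] _ _ /= /finj[-> ->].
by move=> w /allpairsP[[u v] /= [us' vt ->]]; exact: sub.
Qed.

Lemma infinite_seq (T : Type) (A : set T) n : infinite_set A ->
  exists s : seq {classic T}, [/\ uniq s, size s = n & [set` s] `<=` A].
Proof.
move=> Ainf; have [B BA Bn] := @infinite_set_fset {classic T} A n Ainf.
exists (take n (enum_fset B)); split.
- exact/take_uniq/fset_uniq.
- by rewrite size_takel.
- by move=> x /= /mem_take xB; exact: BA.
Qed.

(** [p] splits the three coordinates into a pair of indices, in any of the three cylindrical
    directions. An n by n grid then puts n^2 points of F in a box of side n, against the power
    saving. *)
Lemma power_saving_no_grid (U V W I J : Type) (X : set U) (Y : set V) (Z : set W)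
    (F : set (U * V * W)) (p : I -> J -> U * V * W) (A : set I) (B : set J) :
  (forall i j i' j', p i j = p i' j' -> i = i' /\ j = j') ->
  F `<=` X `*` Y `*` Z ->
  infinite_set A -> infinite_set B -> (forall i j, A i -> B j -> F (p i j)) ->
  (forall (s : set I) (t : set J) n, s #<= `I_n -> t #<= `I_n ->
     exists A' B' C', [/\ A' #<= `I_n, B' #<= `I_n, C' #<= `I_n &
       forall i j, s i -> t j -> (A' `*` B' `*` C') (p i j)]) ->
  ~ power_saving R X Y Z F.
Proof.
move=> pinj FXYZ Ainf Binf Fp box [eps eps0 [k k0 [n0 sav]]].
have [n1 gap] := powR_sub_lt_square k eps0.
pose n := (maxn n0 n1).+1.
have [s [us sn sA]] := infinite_seq n Ainf.
have [t [ut tn tB]] := infinite_seq n Binf.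
have [A' [B' [C' [A'n B'n C'n pbox]]]] : exists A' B' C', [/\ A' #<= `I_n, B' #<= `I_n, C' #<= `I_n &
       forall i j, [set` s] i -> [set` t] j -> (A' `*` B' `*` C') (p i j)].
  by apply: box; apply/card_le_seqP; [exists s|exists t]; rewrite ?sn ?tn.
have n0n : (n0 < n)%N by rewrite ltnS leq_maxl.
(* The box is cut down to X, Y, Z, the only place where power saving applies; F loses no points. *)
have [||||||q Fq qle] := sav n n0n (A' `&` X) (B' `&` Y) (C' `&` Z).
- by move=> x [].
- by move=> x [].
- by move=> x [].
- by apply: card_le_trans A'n; apply: subset_card_le => x [].
- by apply: card_le_trans B'n; apply: subset_card_le => x [].
- by apply: card_le_trans C'n; apply: subset_card_le => x [].
have : (size s * size t <= q)%N.
  move: Fq; rewrite card_eq_le => /andP[Fq _].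
  apply: (size_grid_le pinj us ut) Fq.
  move=> i j si tj; have Fij := Fp _ _ (sA _ si) (tB _ tj).
  split=> //; have [[] ] := FXYZ _ Fij; have [[]] := pbox _ _ si tj.
  by [].
rewrite sn tn -(ler_nat R) natrM => nnq.
have := le_lt_trans (le_trans nnq qle) (gap n _).
by rewrite ltnS leq_maxr expr2 ltxx => /(_ isT).
Qed.

Lemma power_saving_not_cylindrical (U V W : Type) (X : set U) (Y : set V) (Z : set W)
    (F : set (U * V * W)) :
  F `<=` X `*` Y `*` Z -> power_saving R X Y Z F -> ~ cylindrical X Y Z F.
Proof.
move=> FXYZ sav [] [A [B [_ _ Ainf Binf ABF]]].
- apply: (@power_saving_no_grid _ _ _ _ _ X Y Z F (fun i j => (i, j.1, j.2)) A B) sav => //.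
  + by move=> i [j k] i' [j' k'] /= [-> -> ->].
  + by move=> i j Ai Bj; exact: (ABF (i, j)).
  + move=> s t n sn tn; exists s, (fst @` t), (snd @` t); split=> //.
    * exact: card_le_image_II.
    * exact: card_le_image_II.
    * by move=> i j si tj; do 2?split=> //=; exists j.
- apply: (@power_saving_no_grid _ _ _ _ _ X Y Z F (fun i j => (j.1, i, j.2)) A B) sav => //.
  + by move=> i [j k] i' [j' k'] /= [-> -> ->].
  + by move=> i j Ai Bj; exact: (ABF (i, j)).
  + move=> s t n sn tn; exists (fst @` t), s, (snd @` t); split=> //.
    * exact: card_le_image_II.
    * exact: card_le_image_II.
    * by move=> i j si tj; do 2?split=> //=; exists j.
- apply: (@power_saving_no_grid _ _ _ _ _ X Y Z F (fun i j => (j.1, j.2, i)) A B) sav => //.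
  + by move=> i [j k] i' [j' k'] /= [-> -> ->].
  + by move=> i j Ai Bj; exact: (ABF (i, j)).
  + move=> s t n sn tn; exists (fst @` t), (snd @` t), s; split=> //.
    * exact: card_le_image_II.
    * exact: card_le_image_II.
    * by move=> i j si tj; do 2?split=> //=; exists j.
Qed.

End Counting.

(** * Definable groups *)

Section DefinableGroup.
Variables (L : signature) (M : structure L) (P : set (elt M)).
Variables (Γ : ctx (sorts L)) (G : groupType) (iota : G -> tuple_in M Γ).
Hypothesis G_def : definable_group P iota.
Local Open Scope group_scope.

Let iota_inj : injective iota. Proof. by case: G_def. Qed.

Lemma card_le_iota (A : set G) k : (iota @` A #<= `I_k) = (A #<= `I_k).
Proof. by apply: card_le_eql; apply: inj_card_eq => x y _ _ /iota_inj. Qed.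

Lemma finite_iota (A : set G) : finite_set (iota @` A) -> finite_set A.
Proof. by move=> /finite_set_leP[k]; rewrite card_le_iota => Ak; apply/finite_set_leP; exists k. Qed.

Definition group_definable2 (Q : G -> set G) : Prop :=
  @definable_over _ M P (Prod Γ Γ)
    [set u | exists x y, [/\ u.1 = iota x, u.2 = iota y & Q x y]].

Lemma group_definable2_not Q :
  group_definable2 Q -> group_definable2 (fun x => ~` Q x).
Proof.
case: G_def => _ Gdef _ hQ.
have := definable_over_and
  (definable_over_and
    (definable_over_preimage (term_map_fst Γ Γ) Gdef)
    (definable_over_preimage (term_map_snd Γ Γ) Gdef))
  (definable_over_not hQ).
congr definable_over; apply/seteqP; split=> -[u v] /=.
  move=> [[[x _ <-] [y _ <-]] nQ]; exists x, y; split=> // Qxy.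
  by apply: nQ; exists x, y.
move=> [x [y [-> -> nQ]]]; split; first by split; [exists x|exists y].
by case=> x' [y' [/iota_inj <- /iota_inj <-]].
Qed.

Lemma group_definable2_card_le Q k :
  group_definable2 Q -> definable_over P (iota @` [set x | Q x #<= `I_k]).
Proof.
case: G_def => _ Gdef _ hQ.
have := definable_over_and Gdef (@definable_over_card_le _ _ P Γ Γ
  (fun u v => exists x y, [/\ u = iota x, v = iota y & Q x y]) k hQ).
have QE x : [set v | exists x0 y, [/\ iota x = iota x0, v = iota y & Q x0 y]] = iota @` Q x.
  apply/seteqP; split=> v; first by case=> x' [y [/iota_inj <- -> Qxy]]; exists y.
  by case=> y Qxy <-; exists x, y.
congr definable_over; apply/seteqP; split=> u /=.
  by case=> -[x _ <-] Qx; exists x => //; rewrite /= -card_le_iota -QE.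
case=> x Qx <-; split; first by exists x.
by rewrite -card_le_iota -QE in Qx.
Qed.

Lemma group_definable2_fiber Q x : group_definable2 Q -> definable (iota @` Q x).
Proof.
move=> hQ.
have := @definable_over_fiber _ _ setT Γ Γ _ (iota x) (@subsetT _ _)
  (definable_overS (@subsetT _ _) (@definable_over_preimage L M P (Prod Γ Γ) (Prod Γ Γ)
     (fun u => (u.2, u.1)) _ ltac:(solve_term_map) hQ)).
congr definable_over; apply/seteqP; split=> v /=.
  by case=> x' [y [/iota_inj <- -> Qxy]]; exists y.
by case=> y Qxy <-; exists x, y.
Qed.

Let mul_graph : set (tuple_in M (Prod (Prod Γ Γ) Γ)) :=
  [set t | exists x y : G, t = (iota x, iota y, iota (x * y))].

Let mul_graphP x y w : mul_graph (iota x, iota y, w) <-> w = iota (x * y).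
Proof.
split=> [[x' [y' [/iota_inj <- /iota_inj <-]]] //|->].
by exists x, y.
Qed.

Lemma group_definable2_commute : group_definable2 (fun x => centralizer x).
Proof.
case: G_def => _ _ mdef.
have := @definable_over_exists _ _ P (Prod Γ Γ) Γ
  (fun u w => mul_graph (u.1, u.2, w) /\ mul_graph (u.2, u.1, w))
  (definable_over_and
    (@definable_over_preimage L M P (Prod (Prod Γ Γ) Γ) (Prod (Prod Γ Γ) Γ)
      (fun a => (a.1.1, a.1.2, a.2)) _ ltac:(solve_term_map) mdef)
    (@definable_over_preimage L M P (Prod (Prod Γ Γ) Γ) (Prod (Prod Γ Γ) Γ)
      (fun a => (a.1.2, a.1.1, a.2)) _ ltac:(solve_term_map) mdef)).
congr definable_over; apply/seteqP; split=> -[u v] /=.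
  move=> [w [[x [y [-> -> ->]]] /mul_graphP/iota_inj xy]].
  by exists x, y.
move=> [x [y [-> -> xy]]]; exists (iota (x * y)).
by split; apply/mul_graphP; rewrite ?xy.
Qed.

(** The existential pair consists of the conjugating element and the common value of the two
    products. *)
Lemma group_definable2_conj : group_definable2 (fun x => conj_class x).
Proof.
case: G_def => _ _ mdef.
have := @definable_over_exists _ _ P (Prod Γ Γ) (Prod Γ Γ)
  (fun u w => mul_graph (w.1, u.2, w.2) /\ mul_graph (u.1, w.1, w.2))
  (definable_over_and
    (@definable_over_preimage L M P (Prod (Prod Γ Γ) (Prod Γ Γ)) (Prod (Prod Γ Γ) Γ)
      (fun a => (a.2.1, a.1.2, a.2.2)) _ ltac:(solve_term_map) mdef)
    (@definable_over_preimage L M P (Prod (Prod Γ Γ) (Prod Γ Γ)) (Prod (Prod Γ Γ) Γ)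
      (fun a => (a.1.1, a.2.1, a.2.2)) _ ltac:(solve_term_map) mdef)).
congr definable_over; apply/seteqP; split=> -[u v] /=.
  move=> [[s w] [[y [x [-> -> ->]]] [z [y' [-> /iota_inj <- /iota_inj yx]]]]].
  by exists z, x; split=> //; exists y.
move=> [x [y [-> -> [z zy]]]]; exists (iota z, iota (z * y)).
by split; apply/mul_graphP; rewrite ?zy.
Qed.

(** The identity is expressed as the idempotent element of G. *)
Lemma definable_product1 :
  @definable_over _ M P (Prod (Prod Γ Γ) Γ)
    [set u | exists x y z, [/\ u.1.1 = iota x, u.1.2 = iota y, u.2 = iota z & x * y * z = 1]].
Proof.
case: G_def => _ _ mdef.
have := @definable_over_exists _ _ P (Prod (Prod Γ Γ) Γ) (Prod Γ Γ)
  (fun u w => mul_graph (u.1.1, u.1.2, w.1) /\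
    (mul_graph (w.1, u.2, w.2) /\ mul_graph (w.2, w.2, w.2)))
  (definable_over_and
    (@definable_over_preimage L M P (Prod (Prod (Prod Γ Γ) Γ) (Prod Γ Γ)) (Prod (Prod Γ Γ) Γ)
      (fun a => (a.1.1.1, a.1.1.2, a.2.1)) _ ltac:(solve_term_map) mdef)
    (definable_over_and
      (@definable_over_preimage L M P (Prod (Prod (Prod Γ Γ) Γ) (Prod Γ Γ)) (Prod (Prod Γ Γ) Γ)
        (fun a => (a.2.1, a.1.2, a.2.2)) _ ltac:(solve_term_map) mdef)
      (@definable_over_preimage L M P (Prod (Prod (Prod Γ Γ) Γ) (Prod Γ Γ)) (Prod (Prod Γ Γ) Γ)
        (fun a => (a.2.2, a.2.2, a.2.2)) _ ltac:(solve_term_map) mdef))).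
congr definable_over; apply/seteqP; split=> -[[u v] w] /=.
  move=> [[s t] /= [[x [y [-> -> ->]]] [[xy [z [/iota_inj <- -> ->]]]]]].
  move=> /mul_graphP/iota_inj e; exists x, y, z; split=> //.
  by apply: (mulIg (x * y * z)); rewrite mul1g -e.
move=> [x [y [z [-> -> -> e]]]]; exists (iota (x * y), iota 1).
by do !split; apply/mul_graphP; rewrite ?e ?mul1g.
Qed.

Hypotheses (G_RM : has_RM (range iota) 1) (G_MD : has_MD (range iota) 1).

Lemma group_infinite : infinite_set [set: G].
Proof.
move=> Gfin; have [/RM_ge1P + _] := G_RM; apply.
exact: finite_image.
Qed.

Lemma group_minimal (A : set G) :
  definable (iota @` A) -> finite_set A \/ finite_set (~` A).
Proof.
case: G_def => _ Gdef _ Adef.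
have AG : iota @` A `<=` range iota by move=> _ [x _ <-]; exists x.
have [fin|fin] := rank1_minimal (definable_overT Gdef) G_RM G_MD Adef AG.
  by left; exact: finite_iota.
right; apply: finite_iota; apply: sub_finite_set fin => _ [x nAx <-].
by split; [exists x|case=> y Ay /iota_inj yx; apply: nAx; rewrite -yx].
Qed.

Lemma definable_group_small_doubling N : exists s t : seq G,
  [/\ uniq s, (N <= size s)%N, (size t <= 2 * size s)%N
    & forall x y, x \in s -> y \in s -> x * y \in t].
Proof.
apply: small_doubling; first exact: group_infinite.
- by move=> a; apply: group_minimal; apply: group_definable2_fiber group_definable2_commute.
- by move=> a; apply: group_minimal; apply: group_definable2_fiber group_definable2_conj.
Qed.

End DefinableGroup.

(** * Group configurations *)

Section GroupConfiguration.
Import Order.TTheory GRing.Theory Num.Theory.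
Variables (L : signature) (M : structure L) (P : set (elt M)).
Variables (Γ : ctx (sorts L)) (G : groupType) (iota : G -> tuple_in M Γ).
Hypothesis G_def : definable_group P iota.
Hypotheses (G_RM : has_RM (range iota) 1) (G_MD : has_MD (range iota) 1).

Variables (Γ1 Γ2 Γ3 : ctx (sorts L)).
Variables (X : set (tuple_in M Γ1)) (Y : set (tuple_in M Γ2)) (Z : set (tuple_in M Γ3)).
Variable F : set (tuple_in M (Prod (Prod Γ1 Γ2) Γ3)).
Hypotheses (X_sm : strongly_minimal X) (Y_sm : strongly_minimal Y).
Hypotheses (F_sub : F `<=` X `*` Y `*` Z) (F_def : definable_over P F).

Variables (R1 : tuple_in M Γ1 -> set (tuple_in M Γ))
  (R2 : tuple_in M Γ2 -> set (tuple_in M Γ))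
  (R3 : tuple_in M Γ3 -> set (tuple_in M Γ)) (N : nat).
Hypotheses (R1_def : @definable_over _ M P (Prod Γ1 Γ) [set p | R1 p.1 p.2])
  (R2_def : @definable_over _ M P (Prod Γ2 Γ) [set p | R2 p.1 p.2])
  (R3_def : @definable_over _ M P (Prod Γ3 Γ) [set p | R3 p.1 p.2]).
Hypotheses (R1_card : forall a, R1 a #<= `I_N) (R2_card : forall a, R2 a #<= `I_N)
  (R3_card : forall a, R3 a #<= `I_N).
Hypotheses (R1_fiber : forall u, [set a | R1 a u] #<= `I_N)
  (R2_fiber : forall u, [set a | R2 a u] #<= `I_N)
  (R3_fiber : forall u, [set a | R3 a u] #<= `I_N).
Local Open Scope group_scope.

Definition configuration (a : tuple_in M (Prod (Prod Γ1 Γ2) Γ3)) (x y z : G) : Prop :=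
  [/\ F a, R1 a.1.1 (iota x), R2 a.1.2 (iota y), R3 a.2 (iota z) & x * y * z = 1].

Lemma definable_configuration :
  @definable_over _ M P (Prod (Prod (Prod Γ1 Γ2) Γ3) (Prod (Prod Γ Γ) Γ))
    [set t | exists x y z, [/\ t.2.1.1 = iota x, t.2.1.2 = iota y, t.2.2 = iota z
                             & configuration t.1 x y z]].
Proof.
pose Δ := Prod (Prod (Prod Γ1 Γ2) Γ3) (Prod (Prod Γ Γ) Γ).
have := definable_over_and
  (definable_over_and
    (@definable_over_preimage L M P Δ (Prod (Prod Γ1 Γ2) Γ3)
      (fun t => t.1) _ ltac:(solve_term_map) F_def)
    (@definable_over_preimage L M P Δ (Prod Γ1 Γ)
      (fun t => (t.1.1.1, t.2.1.1)) _ ltac:(solve_term_map) R1_def))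
  (definable_over_and
    (definable_over_and
      (@definable_over_preimage L M P Δ (Prod Γ2 Γ)
        (fun t => (t.1.1.2, t.2.1.2)) _ ltac:(solve_term_map) R2_def)
      (@definable_over_preimage L M P Δ (Prod Γ3 Γ)
        (fun t => (t.1.2, t.2.2)) _ ltac:(solve_term_map) R3_def))
    (@definable_over_preimage L M P Δ (Prod (Prod Γ Γ) Γ)
      (fun t => t.2) _ ltac:(solve_term_map) (definable_product1 G_def))).
congr definable_over; apply/seteqP; split=> -[a [[u v] w]] /=.
  move=> [[Fa R1a] [[R2a R3a] [x [y [z [ux vy wz xyz]]]]]].
  by exists x, y, z; split=> //; split=> //; rewrite -?ux -?vy -?wz.
move=> [x [y [z [-> -> -> [Fa R1a R2a R3a xyz]]]]].
by do !split=> //; exists x, y, z.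
Qed.

(** Restricting the first factor to [V] turns a definable property of [g1] into a set containing the
    generic point, hence of rank at least 2. *)
Definition configured (V : set G) : set (tuple_in M (Prod (Prod Γ1 Γ2) Γ3)) :=
  [set a | exists x y z, configuration a x y z /\ V x].

Lemma definable_configured V :
  definable_over P (iota @` V) -> definable_over P (configured V).
Proof.
move=> hV; pose Δ := Prod (Prod (Prod Γ1 Γ2) Γ3) (Prod (Prod Γ Γ) Γ).
have := definable_over_and definable_configuration
  (@definable_over_preimage L M P Δ Γ (fun t => t.2.1.1) _ ltac:(solve_term_map) hV).
move/(@definable_over_exists _ _ P (Prod (Prod Γ1 Γ2) Γ3) (Prod (Prod Γ Γ) Γ)
  (fun a u => (exists x y z, [/\ u.1.1 = iota x, u.1.2 = iota y, u.2 = iota z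
                             & configuration a x y z]) /\ (iota @` V) u.1.1)).
congr definable_over; apply/seteqP; split=> a /=.
  move=> [u [[x [y [z [ux uy uz c]]]] [x' Vx' x'u]]]; exists x, y, z; split=> //.
  by case: G_def => iota_inj _ _; rewrite -(iota_inj x' x) // x'u.
move=> [x [y [z [c Vx]]]]; exists (iota x, iota y, iota z); split; last by exists x.
by exists x, y, z.
Qed.

Definition second_factors (x : G) : set G := [set y | exists a z, configuration a x y z].

Lemma definable_second_factors : group_definable2 P iota second_factors.
Proof.
have := @definable_over_exists _ _ P (Prod Γ Γ) (Prod (Prod (Prod Γ1 Γ2) Γ3) Γ)
  (fun u t => exists x y z, [/\ u.1 = iota x, u.2 = iota y, t.2 = iota z
                             & configuration t.1 x y z])
  (@definable_over_preimage L M P (Prod (Prod Γ Γ) (Prod (Prod (Prod Γ1 Γ2) Γ3) Γ))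
    (Prod (Prod (Prod Γ1 Γ2) Γ3) (Prod (Prod Γ Γ) Γ))
    (fun t => (t.2.1, (t.1, t.2.2))) _ ltac:(solve_term_map) definable_configuration).
congr definable_over; apply/seteqP; split=> u /=.
  by move=> [[a w] [x [y [z [ux uy _ c]]]]]; exists x, y; split=> //; exists a, z.
by move=> [x [y [ux uy [a [z c]]]]]; exists (a, iota z), x, y, z.
Qed.

Let card_preimage (A : set (tuple_in M Γ)) : A #<= `I_N -> [set x | A (iota x)] #<= `I_N.
Proof. by case: G_def => iota_inj _ _; exact: card_le_preimage. Qed.

Lemma configuration_third a x y z : configuration a x y z -> z = (x * y)^-1.
Proof. by case=> _ _ _ _ xyz; rewrite (mulg1_eq xyz). Qed.

(** The point [p] leaves N choices for x, then there are k for y, and N for each of the two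
    remaining points, as x and y determine z. *)
Lemma configured_fiber1 V k p :
  (forall x, V x -> second_factors x #<= `I_k) ->
  [set a | configured V a /\ a.1.1 = p] #<= `I_(N * (k * (N * N))).
Proof.
move=> Vk.
pose A := \bigcup_(x in [set x | R1 p (iota x) /\ V x]) \bigcup_(y in second_factors x)
  \bigcup_(b in [set b | R2 b (iota y)])
    ((fun c => (p, b, c)) @` [set c | R3 c (iota (x * y)^-1)]).
apply: (@card_le_trans _ _ _ A).
  apply: subset_card_le => -[[p' b] c] /= [[x [y [z [conf Vx]]]] p'p].
  subst p'; have zE := configuration_third conf.
  case: (conf) => _ /= R1a R2a R3a _.
  exists x => //; exists y; first by exists (p, b, c), z.
  by exists b => //; exists c => //; rewrite -zE.
apply: card_le_bigcup.
  apply: card_le_trans (card_preimage (R1_card p)).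
  by apply: subset_card_le => x [].
move=> x [_ /Vk Tk]; apply: card_le_bigcup => // y _.
apply: card_le_bigcup => // b _.
exact: card_le_image_II.
Qed.

(** Here [V] bounds the choices of x, and [q] leaves N choices for y. *)
Lemma configured_fiber2 V k q :
  V #<= `I_k ->
  [set a | configured V a /\ a.1.2 = q] #<= `I_(k * (N * (N * N))).
Proof.
move=> Vk.
pose A := \bigcup_(x in V) \bigcup_(y in [set y | R2 q (iota y)])
  \bigcup_(b in [set b | R1 b (iota x)])
    ((fun c => (b, q, c)) @` [set c | R3 c (iota (x * y)^-1)]).
apply: (@card_le_trans _ _ _ A).
  apply: subset_card_le => -[[b q'] c] /= [[x [y [z [conf Vx]]]] q'q].
  subst q'; have zE := configuration_third conf.
  case: (conf) => _ /= R1a R2a R3a _.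
  exists x => //; exists y => //.
  by exists b => //; exists c => //; rewrite -zE.
apply: card_le_bigcup => // x _; apply: card_le_bigcup.
  exact: (card_preimage (R2_card q)).
move=> y _; apply: card_le_bigcup => // b _.
exact: card_le_image_II.
Qed.

Lemma configured_sub V : configured V `<=` F.
Proof. by move=> a [x [y [z [[]]]]]. Qed.

(** * Configurations at a generic point *)

Section Generic.
Variables (alpha : tuple_in M (Prod (Prod Γ1 Γ2) Γ3)) (g1 g2 g3 : G).
Hypothesis alpha_configuration : configuration alpha g1 g2 g3.
Hypothesis alpha_generic : forall D, definable_over P D -> D alpha -> RM_ge 2 D.

Let configured_generic V : definable_over P (iota @` V) -> V g1 -> RM_ge 2 (configured V).
Proof.
move=> hV Vg1; apply: alpha_generic; first exact: definable_configured.
by exists g1, g2, g3.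
Qed.

(** If [g1] had only k second factors, the configurations whose x has at most k of them would be
    boundedly finite over X, yet of rank 2. *)
Lemma second_factors_infinite : infinite_set (second_factors g1).
Proof.
move=> /finite_set_leP[k g1k].
pose V := [set x | second_factors x #<= `I_k].
have rV : RM_ge 2 (configured V).
  apply: configured_generic g1k.
  exact: (group_definable2_card_le G_def) definable_second_factors.
apply: (@bounded_to_one_RM L M (Prod (Prod Γ1 Γ2) Γ3) Γ1 _ (fun a => a.1.1) _ _ X_sm _ _ _ rV).
- solve_term_map.
- by move=> a /configured_sub/F_sub[[]].
- by move=> p; exact: (@configured_fiber1 V k p).
Qed.

(** By minimality [g1] misses only finitely many second factors, say at most k. Let U be the set of
    all x missing at most k: if U were finite, its configurations would be boundedly finite over Y,
    yet of rank 2. *)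
Lemma second_factors_cofinite :
  exists2 U : set G, finite_set (~` U) & forall x, U x -> finite_set (~` second_factors x).
Proof.
have fdef := definable_second_factors.
have [|/finite_set_leP[k g1k]] := group_minimal G_def G_RM G_MD (group_definable2_fiber G_def g1 fdef).
  by move/second_factors_infinite.
pose U := [set x | ~` second_factors x #<= `I_k].
have U_def : definable_over P (iota @` U).
  exact: (group_definable2_card_le G_def) (group_definable2_not G_def fdef).
exists U; last by move=> x Ux; apply/finite_set_leP; exists k.
have [/finite_set_leP[l Ul]|//] := group_minimal G_def G_RM G_MD (definable_overT U_def).
exfalso; apply: (@bounded_to_one_RM L M (Prod (Prod Γ1 Γ2) Γ3) Γ2 _ (fun a => a.1.2)
  _ _ Y_sm _ _ _ (configured_generic U_def g1k)).
- solve_term_map.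
- by move=> a /configured_sub/F_sub[[]].
- by move=> q; exact: (@configured_fiber2 U l q).
Qed.

(* For x in a cofinite set U, almost all y give a point of F; choose g with *)
(* g s in U, then h with s h in the intersection of finitely many cofinite  *)
(* sets.                                                                    *)
Lemma configuration_grid (s : seq G) :
  exists g h, forall x y, x \in s -> y \in s ->
    exists a, configuration a (g * x) (y * h) (g * x * (y * h))^-1.
Proof.
have [U Ucofin Ux] := second_factors_cofinite.
have Ginf := group_infinite G_RM.
have cofin (I : choiceType) (t : seq I) (A : I -> set G) :
    (forall i, i \in t -> finite_set (~` A i)) -> exists g, forall i, i \in t -> A i g.
  move=> Afin; apply: contrapT => nog; apply: Ginf.
  apply: (@sub_finite_set _ _ (\bigcup_(i in [set` t]) ~` A i)).
    move=> g _; apply: contrapT => hg; apply: nog; exists g => i ti.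
    by apply: contrapT => nA; apply: hg; exists i.
  by apply: bigcup_finite => //; exact: finite_seq.
have inj_translate (f : G -> G) (A : set G) : injective f -> finite_set A -> finite_set [set x | A (f x)].
  move=> finj Afin; apply: finite_preimage => //.
  by move=> x y _ _ /finj.
have [g gP] : exists g, forall x, x \in s -> U (g * x).
  apply: (cofin _ s (fun x g => U (g * x))) => x _.
  by apply: (inj_translate (fun g => g * x) (~` U)) => //; exact: mulIg.
have [h hP] : exists h, forall p, p \in [seq (x, y) | x <- s, y <- s] ->
    second_factors (g * p.1) (p.2 * h).
  apply: (cofin _ _ (fun p h => second_factors (g * p.1) (p.2 * h))).
  move=> _ /allpairsP[[x y] /= [xs ys ->]].
  apply: (inj_translate (fun h => y * h) (~` second_factors (g * x))).
    exact: mulgI.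
  exact/Ux/gP.
exists g, h => x y xs ys.
have [a [z conf]] := hP (x, y) (allpairs_f pair xs ys).
by exists a; rewrite -(configuration_third conf).
Qed.

Lemma configuration_not_power_saving (R : realType) : ~ power_saving R X Y Z F.
Proof.
move=> [eps eps0 [k k0 [n0 sav]]].
(* With n = 2 |s| N and |s|^2 at most q N^2, where q counts the points of F in the box, n^2 is at
   most 4 N^4 q. *)
have [n1 gap] := powR_sub_lt_square ((4 * N ^ 4)%:R * k)%R eps0.
have [s [t [us s_large ts st]]] :=
  definable_group_small_doubling G_def G_RM G_MD (maxn n0 n1).+1.
have [g [h grid]] := configuration_grid s.
have N0 : (0 < N)%N.
  rewrite lt0n; apply/eqP => N0.
  have := R1_card alpha.1.1; rewrite N0 II0 card_le0 => /eqP R10.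
  by case: alpha_configuration => _; rewrite R10.
(* The longest side is the third: it has at most |t| N points, and |t| is at most 2 |s|. *)
pose n := (2 * size s * N)%N.
have sn : (size s * N <= n)%N by rewrite /n -mulnA mul2n -addnn leq_addr.
have s_le_n : (size s <= n)%N by apply: leq_trans sn; rewrite leq_pmulr.
have n0n : (n0 < n)%N.
  by apply: leq_trans s_le_n; apply: leq_trans s_large; rewrite ltnS leq_maxl.
have n1n : (n1 < n)%N.
  by apply: leq_trans s_le_n; apply: leq_trans s_large; rewrite ltnS leq_maxr.
pose A := X `&` \bigcup_(x in [set` s]) [set a | R1 a (iota (g * x))].
pose B := Y `&` \bigcup_(y in [set` s]) [set a | R2 a (iota (y * h))].
pose C := Z `&` \bigcup_(w in [set` t]) [set a | R3 a (iota (g * w * h)^-1)].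
have An : A #<= `I_n.
  apply: (card_le_trans (subset_card_le (@subIsetr _ _ _))).
  apply: (@card_le_trans _ _ _ `I_(size s * N)); last by rewrite card_le_II.
  by apply: card_le_bigcup => //; exact: card_le_size.
have Bn : B #<= `I_n.
  apply: (card_le_trans (subset_card_le (@subIsetr _ _ _))).
  apply: (@card_le_trans _ _ _ `I_(size s * N)); last by rewrite card_le_II.
  by apply: card_le_bigcup => //; exact: card_le_size.
have Cn : C #<= `I_n.
  apply: (card_le_trans (subset_card_le (@subIsetr _ _ _))).
  apply: (@card_le_trans _ _ _ `I_(size t * N)); last first.
    by rewrite card_le_II leq_mul2r ts orbT.
  by apply: card_le_bigcup => //; exact: card_le_size.
have [q] := sav n n0n A B C (@subIsetl _ _ _) (@subIsetl _ _ _) (@subIsetl _ _ _) An Bn Cn.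
rewrite card_eq_le => /andP[Fq _] q_le.
(* Each point of F in the box accounts for at most N^2 pairs (x, y) of the grid. *)
pose pairs := \bigcup_(a in F `&` (A `*` B `*` C))
  \bigcup_(x in [set x | R1 a.1.1 (iota (g * x))])
    (pair x @` [set y | R2 a.1.2 (iota (y * h))]).
have iota_inj : injective iota by case: G_def.
have pairs_card : pairs #<= `I_(q * (N * N)).
  apply: card_le_bigcup => // a _; apply: card_le_bigcup.
    by apply: (card_le_preimage (f := fun x => iota (g * x))) => // x y /iota_inj/mulgI.
  move=> x _; apply: card_le_image_II.
  by apply: (card_le_preimage (f := fun y => iota (y * h))) => // y z /iota_inj/mulIg.
have : (size s * size s <= q * (N * N))%N.
  rewrite -(size_allpairs (@pair G G)).
  apply: size_le_card pairs_card; first by apply: allpairs_uniq => // -[x y] [].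
  move=> _ /allpairsP[[x y] /= [xs ys ->]].
  have [a aconf] := grid x y xs ys; case: (aconf) => Fa R1a R2a R3a _.
  exists a; last by exists x => //; exists y.
  have [[Xa Ya] Za] := F_sub Fa; split=> //; split; first split; split=> //.
  - by exists x.
  - by exists y.
  - by exists (x * y); [exact: st|rewrite /= -!mulgA in R3a *].
move=> ssq.
have : (n * n <= 4 * N ^ 4 * q)%N.
  have -> : (n * n = 4 * N ^ 2 * (size s * size s))%N.
    by rewrite /n -mulnn; ring.
  have -> : (4 * N ^ 4 * q = 4 * N ^ 2 * (q * (N * N)))%N.
    by rewrite (_ : N ^ 4 = N ^ 2 * N ^ 2)%N -?expnD // -mulnn; ring.
  by rewrite leq_mul2l ssq orbT.
rewrite -(ler_nat R) (natrM _ n n) (natrM _ (4 * N ^ 4) q) => nq.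
have := gap n n1n; apply/negP; rewrite -leNgt expr2; apply: (le_trans nq).
by rewrite -mulrA ler_wpM2l.
Qed.

Lemma configuration_not_cylindrical :
  has_RM F 2 -> has_MD F 1 -> ~ cylindrical X Y Z F.
Proof.
move=> F_RM F_MD cyl; pose F' := configured setT.
have F'_def : definable_over P F' by apply: definable_configured; case: G_def.
have F'_RM : RM_ge 2 F' by apply: configured_generic => //; case: G_def.
have FT := definable_overT F_def; have F'T := definable_overT F'_def.
(* The three directions are treated alike: [p] inserts the coordinate u into v, and [f] forgets it.
   Over each v in B, discarding the finitely many u with a point in F' leaves an infinite fibre of F
   minus F'. *)
have no_fibers (Γu Γv : ctx (sorts L)) (A : set (tuple_in M Γu)) (B : set (tuple_in M Γv))
    (p : tuple_in M Γu -> tuple_in M Γv -> tuple_in M (Prod (Prod Γ1 Γ2) Γ3))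
    (f : tuple_in M (Prod (Prod Γ1 Γ2) Γ3) -> tuple_in M Γv) :
    term_map f -> (forall u v, f (p u v) = v) -> (forall v, injective (p^~ v)) ->
    (forall v, finite_set [set u | F' (p u v)]) ->
    infinite_set A -> infinite_set B -> (forall u v, A u -> B v -> F (p u v)) -> False.
  move=> f_term fp pinj F'fin Ainf Binf ABF.
  apply: (degree1_indecomposable FT F_RM F_MD F'T (@configured_sub _) F'_RM).
  apply: (RM_ge2_fibers (definable_setD FT F'T) f_term Binf) => v Bv fin.
  have := infinite_setD Ainf (F'fin v); apply.
  rewrite -(eq_finite_set (inj_card_eq (f := p^~ v) _)); last by move=> x y _ _ /pinj.
  by apply: sub_finite_set fin => _ [u [Au nF'] <-]; split; [split=> //; exact: ABF|].
have F'_mul a b c : F' (a, b, c) -> exists x y z,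
    [/\ R1 a (iota x), R2 b (iota y), R3 c (iota z) & x * y * z = 1].
  by move=> [x [y [z [[_ R1a R2b R3c xyz] _]]]]; exists x, y, z.
have finR1 := fun A => card_preimage (R1_card A).
have finR2 := fun A => card_preimage (R2_card A).
have finR3 := fun A => card_preimage (R3_card A).
case: cyl => -[A [B [_ _ Ainf Binf ABF]]].
- apply: (no_fibers Γ1 (Prod Γ2 Γ3) A B (fun u v => (u, v.1, v.2)) (fun a => (a.1.2, a.2))) => //.
  + solve_term_map.
  + by move=> u [].
  + by move=> v u u' [].
  + move=> [b c]; apply: (@sub_finite_set _ _ (\bigcup_(y in [set y | R2 b (iota y)])
      \bigcup_(z in [set z | R3 c (iota z)]) [set a | R1 a (iota (y * z)^-1)])).
      move=> a /F'_mul[x [y [z [R1a R2b R3c xyz]]]]; exists y => //; exists z => //=.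
      by rewrite -mulgA in xyz; rewrite -(mulg1_eq xyz) invgK.
    apply/finite_set_leP; exists (N * (N * N))%N.
    by apply: card_le_bigcup => // y _; apply: card_le_bigcup.
  + by move=> u v Au Bv; exact: (ABF (u, v)).
- apply: (no_fibers Γ2 (Prod Γ1 Γ3) A B (fun u v => (v.1, u, v.2)) (fun a => (a.1.1, a.2))) => //.
  + solve_term_map.
  + by move=> u [].
  + by move=> v u u' [].
  + move=> [a c]; apply: (@sub_finite_set _ _ (\bigcup_(x in [set x | R1 a (iota x)])
      \bigcup_(z in [set z | R3 c (iota z)]) [set b | R2 b (iota (x^-1 * z^-1))])).
      move=> b /F'_mul[x [y [z [R1a R2b R3c xyz]]]]; exists x => //; exists z => //=.
      by rewrite -mulgA in xyz; rewrite (mulg1_eq xyz) mulgK.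
    apply/finite_set_leP; exists (N * (N * N))%N.
    by apply: card_le_bigcup => // y _; apply: card_le_bigcup.
  + by move=> u v Au Bv; exact: (ABF (u, v)).
- apply: (no_fibers Γ3 (Prod Γ1 Γ2) A B (fun u v => (v.1, v.2, u)) (fun a => a.1)) => //.
  + solve_term_map.
  + by move=> u [].
  + by move=> v u u' [].
  + move=> [a b]; apply: (@sub_finite_set _ _ (\bigcup_(x in [set x | R1 a (iota x)])
      \bigcup_(y in [set y | R2 b (iota y)]) [set c | R3 c (iota (x * y)^-1)])).
      move=> c /F'_mul[x [y [z [R1a R2b R3c xyz]]]]; exists x => //; exists y => //=.
      by rewrite (mulg1_eq xyz).
    apply/finite_set_leP; exists (N * (N * N))%N.
    by apply: card_le_bigcup => // y _; apply: card_le_bigcup.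
  + by move=> u v Au Bv; exact: (ABF (u, v)).
Qed.

End Generic.
End GroupConfiguration.

Lemma group_like_exclusive (R : realType) (K : Type) (L : signature) (M : structure L)
    (B : set (elt M)) (Γ1 Γ2 Γ3 : ctx (sorts L))
    (X : set (tuple_in M Γ1)) (Y : set (tuple_in M Γ2)) (Z : set (tuple_in M Γ3))
    (F : set (tuple_in M (Prod (Prod Γ1 Γ2) Γ3))) :
  strongly_minimal X -> strongly_minimal Y -> F `<=` X `*` Y `*` Z ->
  definable_over B F -> has_RM F 2 -> has_MD F 1 -> group_like K B X Y Z F ->
  ~ power_saving R X Y Z F /\ ~ cylindrical X Y Z F.
Proof.
move=> X_sm Y_sm F_sub F_defB F_RM F_MD [C]; set P := B `|` _ => -[_ _].
move=> [Γ [G [iota [G_def G_RM G_MD]]]].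
move=> [g1 [g2 [g3 [a1 [a2 [a3 [_ [alg1 alg2 alg3] [Fa [n [F_n [_ a_n]]]] g123]]]]]]].
(* Genericity mentions some rank of F; by uniqueness it is 2. *)
rewrite (has_RM_uniq F_n F_RM) in a_n.
have F_def : definable_over P F by apply: definable_overS F_defB; exact: subsetUl.
have [N1 [R1 [R1_def R1a R1_card R1_fiber]]] := interalgebraic_family alg1.
have [N2 [R2 [R2_def R2a R2_card R2_fiber]]] := interalgebraic_family alg2.
have [N3 [R3 [R3_def R3a R3_card R3_fiber]]] := interalgebraic_family alg3.
pose N := (N1 + N2 + N3)%N.
have le1 T (A : set T) : A #<= `I_N1 -> A #<= `I_N.
  by move=> AN; apply: card_le_trans AN _; rewrite card_le_II /N -addnA leq_addr.
have le2 T (A : set T) : A #<= `I_N2 -> A #<= `I_N.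
  by move=> AN; apply: card_le_trans AN _; rewrite card_le_II /N addnAC leq_addl.
have le3 T (A : set T) : A #<= `I_N3 -> A #<= `I_N.
  by move=> AN; apply: card_le_trans AN _; rewrite card_le_II /N leq_addl.
have conf : configuration iota F R1 R2 R3 (a1, a2, a3) g1 g2 g3 by [].
have c1 a := le1 _ _ (R1_card a); have f1 u := le1 _ _ (R1_fiber u).
have c2 a := le2 _ _ (R2_card a); have f2 u := le2 _ _ (R2_fiber u).
have c3 a := le3 _ _ (R3_card a); have f3 u := le3 _ _ (R3_fiber u).
split.
- exact: (configuration_not_power_saving G_def G_RM G_MD X_sm Y_sm F_sub F_def
    R1_def R2_def R3_def c1 c2 f1 f2 f3 conf a_n).
- exact: (configuration_not_cylindrical G_def F_def
    R1_def R2_def R3_def c1 c2 c3 f1 f2 f3 conf a_n F_RM F_MD).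
Qed.

Theorem proposition1p7 (R : realType) (K : Type) (L : signature)
  (M : structure L) (M_saturated : sufficiently_saturated K M)
  (Γ1 Γ2 Γ3 : ctx (sorts L))
  (X : set (tuple_in M Γ1)) (Y : set (tuple_in M Γ2)) (Z : set (tuple_in M Γ3))
  (X_sm : strongly_minimal X) (Y_sm : strongly_minimal Y)
  (Z_sm : strongly_minimal Z)
  (F : set (tuple_in M (Prod (Prod Γ1 Γ2) Γ3)))
  (F_sub : F `<=` X `*` Y `*` Z)
  (B : set (elt M)) (B_small : small K B)
  (X_def : definable_over B X) (Y_def : definable_over B Y)
  (Z_def : definable_over B Z) (F_def : definable_over B F)
  (F_RM : has_RM F 2) (F_MD : has_MD F 1) :
  [/\ ~ (power_saving R X Y Z F /\ group_like K B X Y Z F),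
      ~ (group_like K B X Y Z F /\ cylindrical X Y Z F)
    & ~ (power_saving R X Y Z F /\ cylindrical X Y Z F)].
Proof.
have exclusive := group_like_exclusive R X_sm Y_sm F_sub F_def F_RM F_MD.
split=> -[].
- by move=> sav /exclusive[].
- by move=> /exclusive[].
- exact: power_saving_not_cylindrical.
Qed.
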